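(* Let $C:f=0$ be a reduced curve of degree $d\ge 3$ in $\mathbb{P}^2$ (over $\mathbb{C}$), and suppose that $C$ has type $2B$ and exponents $(d_1,d_2,d_3,d_4)$. Then the following hold. (1) If $d_1<d_2-2$, then $\nu(C)=d_3+d_4-2d_2+3\geq 3$. (2) If $d_1=d_2-2$, then $\nu(C)=d_3+d_4-2d_1-1\geq 3$. (3) If $d_1=d_2-1$, then $\nu(C)=d_3+d_4-2d_1+1\geq 3$. (4) If $d_1=d_2$, then $\nu(C)=d_3+d_4-2d_2+2\geq 2$.
   Context: Let $S=\mathbb{C}[x,y,z]$ with its standard grading. For a reduced curve $C:f=0$ of degree $d$ in $\mathbb{P}^2=\mathbb{P}^2_{\mathbb{C}}$, let $$D_0(f)=\{(a,b,c)\in S^3 : af_x+bf_y+cf_z=0\}$$ be the graded $S$-module of Jacobian syzygies, where a homogeneous element $(a,b,c)$ has degree $k$ if $a,b,c$ are homogeneous of degree $k$. Let $d_1\leq d_2\leq\dots\leq d_m$ be the degrees of the elements of a minimal system of homogeneous generators of $D_0(f)$; $(d_1,\dots,d_m)$ are the exponents of $C$. The type of $C$ is $t(C)=d_1+d_2+1-d$. A curve of type $2$ has $m=3$ or $m=4$; it is said to be of type $2A$ if $m=3$ and of type $2B$ if $m=4$. Let $J_f=(f_x,f_y,f_z)$ be the Jacobian ideal, $I_f$ its saturation with respect to $\mathbf{m}=(x,y,z)$, and $N(f)=I_f/J_f$ the graded Jacobian module. The freeness defect of $C$ is $\nu(C)=\max_j\{\dim_{\mathbb{C}} N(f)_j\}$.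 *)

(* Defs.v *)
From HB Require Import structures.
From mathcomp Require Import all_boot all_order all_algebra.
From mathcomp Require Import reals complex mpoly.
Set Implicit Arguments.
Unset Strict Implicit.
Unset Printing Implicit Defensive.
Import Order.TTheory GRing.Theory Num.Theory.
Local Open Scope ring_scope.

Section GeneratingFamilies.
Variables (A : pzRingType) (V : lmodType A).

(* The subfamily (g i), i in I, spans exactly the submodule M. *)
Definition generates (M : V -> Prop) (m : nat) (g : 'I_m -> V)
    (I : {set 'I_m}) : Prop :=
  forall v : V, M v <-> exists c : 'I_m -> A, v = \sum_(i in I) c i *: g i.

Definition minimal_generators (M : V -> Prop) (m : nat) (g : 'I_m -> V)
    : Prop :=
  generates M g [set: 'I_m] /\
  forall I : {set 'I_m}, generates M g I -> I = [set: 'I_m].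

End GeneratingFamilies.

(* dim_K (U / W) = k, for subspaces W <= U of V: k elements of U represent a
   basis of U / W. *)
Definition quotient_dim (K : fieldType) (V : lmodType K) (U W : V -> Prop)
    (k : nat) : Prop :=
  exists v : 'I_k -> V,
    [/\ forall i, U (v i),
        forall u, U u -> exists a : 'I_k -> K, W (u - \sum_(i < k) a i *: v i)
      & forall a : 'I_k -> K, W (\sum_(i < k) a i *: v i) ->
          forall i, a i = 0].

Section Ideals.
Variable A : comNzRingType.

Definition ideal_gen (m : nat) (g : 'I_m -> A) (p : A) : Prop :=
  exists c : 'I_m -> A, p = \sum_(i < m) c i * g i.

(* The union over k of the colon ideals (J : I ^ k), where I ^ k is generated
   by the products of k elements of I. *)
Definition saturation (I J : A -> Prop) (p : A) : Prop :=
  exists k : nat, forall u : 'I_k -> A,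
    (forall i, I (u i)) -> J ((\prod_(i < k) u i) * p).

End Ideals.

Definition squarefree (A : comUnitRingType) (f : A) : Prop :=
  f != 0 /\ forall g h : A, f = g ^+ 2 * h -> g \is a GRing.unit.

Section PlaneCurves.
Variable R : realType.

Notation S := {mpoly R[i][3]}.
Implicit Types (f : S) (d : nat) (e : seq nat).

Definition reduced_curve d f : Prop := f \is d.-homog /\ squarefree f.

(* D_0(f); the triple (a, b, c) is a row vector. *)
Definition jacobian_syzygy f (r : 'rV[S]_3) : Prop :=
  \sum_(i < 3) r 0 i * f^`M(i) = 0.

Definition homog_triple (k : nat) (r : 'rV[S]_3) : Prop :=
  forall i, r 0 i \is k.-homog.

Definition exponents f e : Prop :=
  sorted leq e /\
  exists r : 'I_(size e) -> 'rV[S]_3,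
    minimal_generators (jacobian_syzygy f) r /\
    forall i : 'I_(size e), homog_triple (nth 0%N e i) (r i).

(* d_1 is at index 0. *)
Definition curve_type d e : int :=
  (nth 0%N e 0)%:Z + (nth 0%N e 1)%:Z + 1 - d%:Z.

Definition type2B d e : Prop := curve_type d e = 2 /\ size e = 4%N.

Definition jacobian_ideal f : S -> Prop := ideal_gen (fun i : 'I_3 => f^`M(i)).

Definition irrelevant_ideal : S -> Prop := ideal_gen (fun i : 'I_3 => 'X_i).

Definition saturated_jacobian_ideal f : S -> Prop :=
  saturation irrelevant_ideal (jacobian_ideal f).

Definition graded_part (I : S -> Prop) (j : nat) (p : S) : Prop :=
  I p /\ p \is j.-homog.

(* dim_C N(f)_j = k, where N(f)_j = (I_f)_j / (J_f)_j. *)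
Definition jacobian_module_dim f (j k : nat) : Prop :=
  quotient_dim (graded_part (saturated_jacobian_ideal f) j)
               (graded_part (jacobian_ideal f) j) k.

(* nu is the maximum over j of dim_C N(f)_j. *)
Definition freeness_defect f (nu : nat) : Prop :=
  (exists j, jacobian_module_dim f j nu) /\
  forall j, exists2 k, jacobian_module_dim f j k & (k <= nu)%N.

End PlaneCurves.

(* Main.v *)
From HB Require Import structures.
Require Import Defs.
From mathcomp Require Import all_boot all_order all_algebra.
From mathcomp Require Import reals complex mpoly ring zify.
From mathcomp Require boolp.
Set Implicit Arguments.
Unset Strict Implicit.
Unset Printing Implicit Defensive.
Import Order.TTheory GRing.Theory Num.Theory.
Local Open Scope ring_scope.

(** Write F for the column of the partial derivatives of f, N = d - 1 for their
degree, D0 for the syzygies of F and r_0, ..., r_3 for the minimal generators of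
D0, of degrees d_0 <= ... <= d_3.  As f is squarefree, its partial derivatives
have no common factor ([gradient_primitive]).

The relations between the r_i are a third syzygy module over a polynomial ring
in three variables, so they form a free module, here of rank two
([greedy_independent], [relation_basis_exists]).  Let e_0 <= e_1 be the degrees
of a homogeneous basis rho_0, rho_1.  Minimality of the generators gives
e_0 > d_2 and e_1 > d_3 ([relation_degree_ge]).  The cross product of two
syzygies is orthogonal to both, hence a multiple of F, and this defines a
skew-symmetric pairing on D0.  Up to sign, the pairings of the r_i are
proportional to the complementary 2 x 2 minors of (rho_0, rho_1); both families
are without common factor, so the ratio is a constant, and comparing degrees
gives e_0 + e_1 = d_0 + d_1 + d_2 + d_3 - N ([degree_sum]).  For a curve of
type 2 we have N = d_0 + d_1 - 2, which forces e_0 = d_2 + 1 and e_1 = d_3 + 1.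

The same pairing makes D0 self-dual: pairing with the r_i identifies D0 with the
kernel of the map S^4 -> S^2 given by the transposed matrix of relations
([theta_iso]).  So F : S^3 -> S and this map have isomorphic kernels, and then
the saturation of the image modulo the image is the same for both
([related_exists], [related_image]): each of these quotients is the first
cohomology of the vector bundle attached to D0.  For F it is N(f).  For the other
map the Hilbert function of the cokernel is an alternating sum of binomial
coefficients ([dim_cokernel]) that vanishes in large degrees, so the saturation
of the image is all of S^2 and the quotient is the whole cokernel.  Hence the
dimension of N(f) in degree t + N is the explicit piecewise linear function
[cokernel_count] of t ([dim_jacobian_module]); its maximum is attained at
t = d_0 - 2 and is the number claimed. *)

(** * Unique factorization in polynomial rings *)
Section Factorial.
Variable A : idomainType.
Implicit Types a b c p q u : A.

Definition divides a b := exists q, b = q * a.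

Definition prime_elt p :=
  [/\ p != 0, p \isn't a GRing.unit &
      forall a b, divides p (a * b) -> divides p a \/ divides p b].

(** The index counts the prime factors; it serves as a termination measure. *)
Inductive prime_product : nat -> A -> Prop :=
| Prime_unit u of u \is a GRing.unit : prime_product 0 u
| Prime_mul n p c of prime_elt p & prime_product n c :
    prime_product n.+1 (p * c).

Lemma divides_mulr a b c : divides a b -> divides a (c * b).
Proof. by case=> q ->; exists (c * q); rewrite mulrA. Qed.

Lemma divides_mull a b c : divides a b -> divides a (b * c).
Proof. by rewrite mulrC; apply: divides_mulr. Qed.

Lemma dividesD a b c : divides a b -> divides a c -> divides a (b + c).
Proof. by case=> q -> [q' ->]; exists (q + q'); rewrite mulrDl. Qed.

Lemma dividesN a b : divides a b -> divides a (- b).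
Proof. by case=> q ->; exists (- q); rewrite mulNr. Qed.

Lemma dividesB a b c : divides a b -> divides a c -> divides a (b - c).
Proof. by move=> ab ac; apply/dividesD/dividesN. Qed.

Lemma divides0 a : divides a 0.
Proof. by exists 0; rewrite mul0r. Qed.

Lemma divides_sum a I (r : seq I) (P : pred I) (F : I -> A) :
  (forall i, P i -> divides a (F i)) -> divides a (\sum_(i <- r | P i) F i).
Proof.
move=> aF; elim/big_rec: _ => [|i b Pi ab]; first exact: divides0.
by apply: dividesD => //; apply: aF.
Qed.

Lemma prime_product_unit n u c : u \is a GRing.unit ->
  prime_product n c -> prime_product n (u * c).
Proof.
move=> Uu; elim=> [v Uv|m p d pp _ IH]; first by constructor; rewrite unitrM Uu.
by rewrite mulrCA; constructor.
Qed.

Lemma prime_productM n m a b : prime_product n a -> prime_product m b ->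
  prime_product (n + m) (a * b).
Proof.
move=> Ha Hb; elim: Ha => [u Uu|k p d pp _ IH].
  exact: prime_product_unit.
by rewrite -mulrA; constructor.
Qed.

(** The prime factors of the product are distributed over the two factors, and
the nonunit q takes at least one of them. *)
Lemma prime_product_cofactor n q c : q \isn't a GRing.unit ->
  prime_product n (q * c) -> exists2 m, (m < n)%N & prime_product m c.
Proof.
move=> NUq; move dE: (q * c) => d Hd.
elim: Hd q c NUq dE => {n d} [u Uu|n p d pp Hd IH] q c NUq dE.
  by move: Uu; rewrite -dE unitrM (negPf NUq).
have [p0 _ pP] := pp.
case: (pP q c); first by rewrite dE mulrC; exists d.
- move=> [q1 qE]; have dE' : q1 * c = d.
    by apply: (mulfI p0); rewrite -dE qE; ring.
  have [Uq1|NUq1] := boolP (q1 \is a GRing.unit).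
    exists n => //; have -> : c = q1^-1 * d by rewrite -dE' mulKr.
    by apply: prime_product_unit => //; rewrite unitrV.
  have [m lemn Hm] := IH _ _ NUq1 dE'.
  by exists m => //; apply: ltnW.
- move=> [c1 cE]; have dE' : q * c1 = d.
    by apply: (mulfI p0); rewrite -dE cE; ring.
  have [m lemn Hm] := IH _ _ NUq dE'.
  by exists m.+1 => //; rewrite cE mulrC; constructor.
Qed.

(** Unique factorization in Kaplansky's form: a domain is factorial as soon as
every nonzero element is a product of prime elements. *)
Definition factorial := forall c, c != 0 -> exists n, prime_product n c.

Lemma unit_of_no_prime : factorial -> forall c, c != 0 ->
  (forall p, prime_elt p -> ~ divides p c) -> c \is a GRing.unit.
Proof.
move=> fA c c0; have [n Hn] := fA _ c0.
case: Hn => // m p d pp _ /(_ p pp) []; exists d; exact: mulrC.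
Qed.

(** The prime factors of c can be cancelled one at a time: each divides all the
products b * h i, but not all the h i, so it divides b. *)
Lemma cancel_coprime (fA : factorial) (I : Type) (h a : I -> A) b c :
  c != 0 -> (forall p, prime_elt p -> ~ forall i, divides p (h i)) ->
  (forall i, c * a i = b * h i) ->
  exists q, b = q * c /\ forall i, a i = q * h i.
Proof.
move=> /[dup] c0 /fA [n Hc] hP ; elim: Hc b a c0 => {n c} [u Uu|n p c pp Hc IH] b a c0 E.
  exists (u^-1 * b); split=> [|i]; first by rewrite mulrAC mulVr ?mul1r.
  by rewrite -mulrA -E mulKr.
have [p0 _ pP] := pp.
have [b1 bE] : divides p b.
  apply: boolp.contrapT => Npb; apply: (hP _ pp) => i.
  case: (pP b (h i)) => //; rewrite -E; exists (c * a i); ring.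
have c00 : c != 0 by apply: contraNneq c0 => ->; rewrite mulr0.
have [|q [bE1 aE]] := IH b1 a c00.
  by move=> i; apply: (mulfI p0); rewrite mulrA E bE; ring.
by exists q; split=> //; rewrite bE bE1; ring.
Qed.

End Factorial.

Section FactorialPoly.
Variable A : idomainType.
Hypothesis fA : factorial A.
Implicit Types f g h : {poly A}.

Lemma divides_polyC (p : A) f :
  divides p%:P f <-> forall i, divides p f`_i.
Proof.
split=> [[q ->] i|H]; first by exists q`_i; rewrite coefMC.
have /fin_all_exists [q qE] : forall i : 'I_(size f), exists q, f`_i = q * p.
  by move=> i; have [q] := H i; exists q.
exists (\poly_(i < size f) (if insub i is Some j then q j else 0)).
apply/polyP => i; rewrite coefMC coef_poly; case: ltnP => [lt|le].
  by rewrite insubT /= -qE.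
by rewrite mul0r nth_default.
Qed.

(** If p divides neither f nor g, take the first coefficient of each that p does
not divide: in the coefficient of f * g of the sum of their degrees, all the
terms but their product are divisible by p. *)
Lemma prime_polyC (p : A) : prime_elt p -> prime_elt p%:P.
Proof.
case=> p0 NUp pP; split; first by rewrite polyC_eq0.
  by rewrite poly_unitE size_polyC coefC eqxx (negPf NUp) andbF.
move=> f g /divides_polyC pfg.
apply: boolp.contrapT => /boolp.not_orP [Nf Ng].
have least h : ~ divides p%:P h -> exists i, ~ divides p h`_i /\
    forall j, (j < i)%N -> divides p h`_j.
  move=> Nh; have [i Hi] : exists i, ~ divides p h`_i.
    by apply: boolp.contrapT => /boolp.forallNP H; apply/Nh/divides_polyC => i;
      apply: boolp.contrapT; apply: H.
  elim/ltn_ind: i Hi => i IH Hi.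
  have [[j [ltji Hj]]|H] := boolp.EM (exists j, (j < i)%N /\ ~ divides p h`_j).
    exact: IH Hj.
  exists i; split=> // j ltji; apply: boolp.contrapT => Hj.
  by apply: H; exists j.
have [i [Hi Li]] := least _ Nf; have [j [Hj Lj]] := least _ Ng.
have lti : (i < (i + j).+1)%N by rewrite ltnS leq_addr.
have := pfg (i + j)%N; rewrite coefM (bigD1 (Ordinal lti)) //= addKn => D.
suff /pP[] : divides p (f`_i * g`_j) by [].
rewrite -[_ * _](addrK (\sum_(k < (i + j).+1 | k != Ordinal lti)
   f`_k * g`_(i + j - k))).
apply: dividesB => //; apply: divides_sum => k /eqP ki.
have [ltki|leik] := ltnP k i; first exact/divides_mull/Li.
have {}ki : (i < k)%N.
  by rewrite ltn_neqAle leik andbT; apply/eqP => E; apply: ki; apply: val_inj.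
apply/divides_mulr/Lj; have := ltn_ord k; rewrite ltnS => kle.
by rewrite ltn_subLR // ltn_add2r.
Qed.

Lemma prime_product_polyC n (c : A) :
  prime_product n c -> prime_product n c%:P.
Proof.
elim=> [u Uu|m p d pp _ IH]; first by constructor; rewrite rmorph_unit.
by rewrite polyCM; constructor=> //; apply: prime_polyC.
Qed.

Definition primitive_poly f :=
  forall p : A, prime_elt p -> ~ divides p%:P f.

(** Prime constants are split off as long as possible; this stops because the
leading coefficient loses a prime factor each time. *)
Lemma content_primitive f : f != 0 ->
  exists (c : A) g, [/\ c != 0, f = c%:P * g & primitive_poly g].
Proof.
rewrite -lead_coef_eq0 => /[dup] lf0 /fA [n].
elim/ltn_ind: n f lf0 => n IH f lf0 Hn.
have [fP|] := boolp.EM (primitive_poly f).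
  by exists 1, f; rewrite oner_neq0 mul1r.
move=> /boolp.existsNP [p /boolp.not_implyP [pp /boolp.contrapT [g fE]]].
have [p0 NUp _] := pp.
have lfE : lead_coef f = p * lead_coef g.
  by rewrite fE lead_coefM lead_coefC mulrC.
have lg0 : lead_coef g != 0 by apply: contraNneq lf0; rewrite lfE => ->; rewrite mulr0.
have [m ltmn Hm] := prime_product_cofactor NUp (eq_ind _ _ Hn _ lfE).
have [c [h [c0 gE hP]]] := IH m ltmn g lg0 Hm.
exists (p * c), h; split; rewrite ?mulf_neq0 //.
by rewrite fE gE polyCM; ring.
Qed.

(** Gauss's lemma: a prime factor of c stays prime in the polynomial ring, so it
divides one of the two factors. *)
Lemma clear_constant (c : A) f g h : c != 0 -> c%:P * f = g * h ->
  exists g' h', [/\ f = g' * h', size g' = size g & size h' = size h].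
Proof.
move=> /[dup] c0 /fA [n Hc]; elim: Hc g h c0 => {n c} [u Uu|n p c pp _ IH] g h c0 E.
  exists (u^-1%:P * g), h; split=> //.
    rewrite -mulrA -E mulrA -polyCM mulVr // mul1r //.
  by rewrite mul_polyC size_scale // invr_eq0; apply: contraTneq Uu => ->; rewrite unitr0.
have [p0 _ _] := pp.
have [pP0 _ pPP] := prime_polyC pp.
have c00 : c != 0 by apply: contraNneq c0 => ->; rewrite mulr0.
have szp k : size (k * p%:P) = size k.
  by rewrite mulrC mul_polyC size_scale.
case: (pPP g h); first by rewrite -E polyCM -mulrA mulrC; exists (c%:P * f).
- case=> g1 gE; have [|g' [h' [fE sg sh]]] := IH g1 h c00.
    by apply: (mulfI pP0); rewrite mulrA -polyCM E gE; ring.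
  by exists g', h'; rewrite gE szp fE sg.
- case=> h1 hE; have [|g' [h' [fE sg sh]]] := IH g h1 c00.
    by apply: (mulfI pP0); rewrite mulrA -polyCM E hE; ring.
  by exists g', h'; rewrite hE szp fE sh.
Qed.

(** A prime factor of c cannot divide the primitive f, so it divides the
cofactor and cancels. *)
Lemma divides_primitive (c : A) f g : c != 0 -> primitive_poly f ->
  divides f (c%:P * g) -> divides f g.
Proof.
move=> c0 fP [q E].
have [n Hc] := fA c0; elim: Hc q c0 E => {n c} [u Uu|n p c pp _ IH] q c0 E.
  by exists (u^-1%:P * q); rewrite -mulrA -E mulrA -polyCM mulVr // mul1r.
have [p0 _ _] := pp.
have [pP0 _ pPP] := prime_polyC pp.
have c00 : c != 0 by apply: contraNneq c0 => ->; rewrite mulr0.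
case: (pPP q f).
- by rewrite -E polyCM -mulrA mulrC; exists (c%:P * g).
- case=> q1 qE; apply: (IH q1) => //.
  apply: (mulfI pP0); transitivity ((p * c)%:P * g); first by rewrite polyCM; ring.
  by rewrite E qE; ring.
- by move=> /(fP _ pp).
Qed.

(** The pseudo-gcd of f and a over A stands for their gcd over the fraction field:
it is either constant, and then f divides b up to a constant, or an associate of f
up to a constant, and then f divides a up to a constant. *)
Lemma prime_irreducible_primitive f : (1 < size f)%N -> primitive_poly f ->
  (forall (c : A) g h, c != 0 -> c%:P * f = g * h ->
     (size g <= 1)%N \/ (size h <= 1)%N) -> prime_elt f.
Proof.
move=> szf fP fI; have f0 : f != 0 by rewrite -size_poly_gt0 ltnW.
split=> //; first by rewrite poly_unitE gtn_eqF.
move=> a b [q abE].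
have := dvdp_gcdl f a; set g := gcdp f a => /Pdiv.Idomain.dvdpP [[c h] /= c0].
rewrite -mul_polyC => E.
have h0 : h != 0.
  by apply: contra_neq (mulf_neq0 (_ : c%:P != 0) f0) => [/(congr1 (fun x => x * g))|];
    rewrite ?E ?mul0r ?polyC_eq0.
have g0 : g != 0 by rewrite gcdp_eq0 (negPf f0).
have [szh|szg] := fI _ _ _ c0 E.
  left; have /size_poly1P [k k0 hE] : size h == 1%N.
    by rewrite eqn_leq szh size_poly_gt0.
  have := dvdp_gcdr f a; rewrite -/g => /Pdiv.Idomain.dvdpP [[c' h'] /= c'0].
  rewrite -mul_polyC => E'.
  apply: (@divides_primitive (k * c')) => //; first by rewrite mulf_neq0.
  exists (c%:P * h').
  by rewrite polyCM -mulrA E' mulrCA -hE -E; ring.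
right; have cop : coprimep f a.
  by rewrite coprimep_def eqn_leq szg size_poly_gt0.
have : f %| b.
  rewrite -(Gauss_dvdpr _ cop); apply/Pdiv.Idomain.dvdpP.
  by exists (1, q); rewrite ?oner_neq0 // scale1r.
move=> /Pdiv.Idomain.dvdpP [[c' h'] /= c'0]; rewrite -mul_polyC => E'.
by apply: (divides_primitive c'0 fP); exists h'.
Qed.

(** Induction on the degree: the content is a product of primes of A, and a
primitive polynomial either is prime or is a product of two polynomials of
smaller positive degree. *)
Lemma factorial_poly : factorial {poly A}.
Proof.
move=> f; have [n] := ubnP (size f); elim: n f => // n IH f; rewrite ltnS => szf f0.
have [c [g [c0 fE gP]]] := content_primitive f0.
have [k Hk] := fA c0.
suff [m Hm] : exists m, prime_product m g.
  by exists (k + m)%N; rewrite fE; apply: prime_productM => //; apply: prime_product_polyC.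
have szg : size g = size f by rewrite fE mul_polyC size_scale.
have g0 : g != 0 by rewrite -size_poly_gt0 szg size_poly_gt0.
have [sz1|szg1] := leqP (size g) 1.
  have /fA [m Hm] : g`_0 != 0.
    by move: g0; rewrite {1}(size1_polyC sz1) polyC_eq0.
  by exists m; rewrite (size1_polyC sz1); apply: prime_product_polyC.
have [gI|] := boolp.EM (forall (c : A) g1 h, c != 0 -> c%:P * g = g1 * h ->
     (size g1 <= 1)%N \/ (size h <= 1)%N).
  exists 1%N; rewrite -[g]mulr1; constructor; last by constructor; apply: unitr1.
  exact: prime_irreducible_primitive.
move=> /boolp.existsNP [b /boolp.existsNP [g1 /boolp.existsNP [h]]].
move=> /boolp.not_implyP [b0 /boolp.not_implyP [E /boolp.not_orP []]].
move=> /negP + /negP; rewrite -!ltnNge => sz1 szh.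
have [g' [h' [gE sg' sh']]] := clear_constant b0 E.
have g'0 : g' != 0 by rewrite -size_poly_gt0 sg' ltnW.
have h'0 : h' != 0 by rewrite -size_poly_gt0 sh' ltnW.
have szE : size g = (size g' + size h').-1 by rewrite gE size_mul.
have [|m1 H1] := IH g' _ g'0.
  apply: leq_trans szf; rewrite -szg szE -subn1 ltn_subRL addnC.
  by rewrite ltn_add2l sh'.
have [|m2 H2] := IH h' _ h'0.
  apply: leq_trans szf; rewrite -szg szE -subn1 ltn_subRL.
  by rewrite ltn_add2r sg'.
by exists (m1 + m2)%N; rewrite gE; apply: prime_productM.
Qed.

End FactorialPoly.

Lemma factorial_iso (A B : idomainType) (phi : {rmorphism A -> B}) :
  bijective phi -> factorial B -> factorial A.
Proof.
move=> [psi phiK psiK] fB c c0.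
have unitE a : (phi a \is a GRing.unit) = (a \is a GRing.unit).
  apply/idP/idP => [/unitrP [v [vE _]]|]; last exact: rmorph_unit.
  apply/unitrP; exists (psi v); rewrite [_ * psi v]mulrC.
  suff: psi v * a = 1 by [].
  by apply: (can_inj phiK); rewrite rmorphM psiK vE rmorph1.
have divE a b : divides (phi a) (phi b) <-> divides a b.
  split=> [[q E]|[q ->]]; last by exists (phi q); rewrite rmorphM.
  exists (psi q); apply: (can_inj phiK); rewrite rmorphM psiK; exact: E.
have [|n] := fB (phi c); first by rewrite -(rmorph0 phi) (can_eq phiK).
move dE: (phi c) => d Hd; exists n.
elim: Hd c dE {c0} => {n d} [u Uu|n p d [p0 NUp pP] _ IH] c dE.
  by constructor; rewrite -unitE dE.
have -> : c = psi p * psi d.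
  by apply: (can_inj phiK); rewrite dE rmorphM !psiK.
constructor; last by apply: IH; rewrite psiK.
split.
- by apply: contraNneq p0 => E; rewrite -[p]psiK E rmorph0.
- by rewrite -unitE psiK.
- move=> a b; rewrite -!divE rmorphM !psiK => /pP; by [].
Qed.

Section FactorialMpoly.
Variable K : fieldType.

Local Notation widen := (widen_ord (leqnSn _)).

(** [muni] singles out the last variable: it turns a polynomial in n + 1 variables
into a univariate one over the polynomials in the first n. *)
Lemma coef_muni n (p : {mpoly K[n.+1]}) (m : 'X_{1..n.+1}) :
  ((muni p)`_(m ord_max))@_[multinom m (widen i) | i < n] = p@_m.
Proof.
rewrite muniE coef_sum raddf_sum /=.
under eq_bigr => k _ do rewrite coefZ coefXn mulr_natr.
rewrite [in RHS](mpolyE p) raddf_sum /=; apply: eq_bigr => k _.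
rewrite raddfMn /= mcoeffZ mcoeffX mcoeffZ mcoeffX -mulrnAr -mulrnA mulnb.
congr (_ * (_ : bool)%:R); apply/andP/eqP => [[/eqP /mnmP E1 /eqP E2]|->] //.
apply/mnmP => i; have [lti|] := ltnP i n; last first.
  move=> lei; suff -> : i = ord_max by [].
  by apply/val_inj/eqP; rewrite eqn_leq lei -ltnS ltn_ord.
have := E1 (Ordinal lti); rewrite !mnmE.
by have -> : widen (Ordinal lti) = i by apply: val_inj.
Qed.

Lemma muni_bij n : bijective (@muni n K).
Proof.
(* The monomial m, with exponent k for the last variable. *)
pose ext (m : 'X_{1..n}) k : 'X_{1..n.+1} :=
  [multinom (if unlift ord_max i is Some j then m j else k) | i < n.+1].
have widenE j : widen j = lift ord_max j :> 'I_n.+1.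
  by apply: val_inj; rewrite /= /bump leqNgt ltn_ord.
have muniX m k : muni ('X_[ext m k] : {mpoly K[n.+1]}) = 'X_[m] *: 'X^k.
  rewrite muniE msuppX big_seq1 mcoeffX eqxx scale1r mnmE unlift_none.
  congr ('X_[_] *: _); apply/mnmP => i.
  by rewrite !mnmE widenE liftK.
pose psi (q : {poly {mpoly K[n]}}) : {mpoly K[n.+1]} :=
  \sum_(i < size q) \sum_(m <- msupp q`_i) q`_i@_m *: 'X_[ext m i].
have psiK : cancel psi (@muni n K).
  move=> q; rewrite /psi raddf_sum /= -[RHS]coefK poly_def.
  apply: eq_bigr => i _; rewrite raddf_sum /= [in RHS](mpolyE q`_i) scaler_suml.
  by apply: eq_bigr => m _; rewrite muniZ muniX scalerA mul_mpolyC.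
exists psi => // p.
have muni_inj : injective (@muni n K).
  move=> a b E; apply/mpolyP => m; by rewrite -!coef_muni E.
by apply: muni_inj; rewrite psiK.
Qed.

Lemma factorial_mpoly n : factorial {mpoly K[n]}.
Proof.
elim: n => [|n IH]; last exact: factorial_iso (muni_bij n) (factorial_poly IH).
move=> c c0; exists 0%N; constructor.
have cE : c = (c@_0)%:MP.
  apply/mpolyP => m; have -> : m = 0%MM by apply/mnmP; case.
  by rewrite mcoeffC eqxx mulr1.
rewrite cE rmorph_unit // unitfE.
by apply: contraNneq c0 => E; rewrite cE E.
Qed.

End FactorialMpoly.

(** * Dimensions of quotients *)
(** The vector spaces below are K-subspaces of free modules over a polynomial ring
A, which carry only an A-module structure; K acts through iota : K -> A. *)
Section QuotientDim.
Variables (K : fieldType) (A : nzRingType) (iota : {rmorphism K -> A}).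
Variable V : lmodType A.
Implicit Types U W T : V -> Prop.

Definition lincomb n (a : 'rV[K]_n) (v : 'I_n -> V) : V :=
  \sum_(i < n) iota (a 0 i) *: v i.

Definition subspace W :=
  W 0 /\ forall a u v, W u -> W v -> W (iota a *: u + v).

Definition qdim U W k :=
  exists v : 'I_k -> V,
    [/\ forall i, U (v i),
        forall u, U u -> exists a : 'rV[K]_k, W (u - lincomb a v)
      & forall a : 'rV[K]_k, W (lincomb a v) -> a = 0].

Lemma subspaceD W u v : subspace W -> W u -> W v -> W (u + v).
Proof. by case=> _ W1 Wu Wv; have := W1 1 _ _ Wu Wv; rewrite rmorph1 scale1r. Qed.

Lemma subspaceZ W a u : subspace W -> W u -> W (iota a *: u).
Proof. by case=> W0 W1 Wu; have := W1 a _ _ Wu W0; rewrite addr0. Qed.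

Lemma subspaceN W u : subspace W -> W u -> W (- u).
Proof.
by move=> sW Wu; have := subspaceZ (-1) sW Wu; rewrite rmorphN1 scaleN1r.
Qed.

Lemma subspaceB W u v : subspace W -> W u -> W v -> W (u - v).
Proof. by move=> sW Wu Wv; apply: subspaceD => //; apply: subspaceN. Qed.

Lemma subspace_sum W I (r : seq I) (P : pred I) (F : I -> V) :
  subspace W -> (forall i, P i -> W (F i)) -> W (\sum_(i <- r | P i) F i).
Proof.
move=> sW WF; elim/big_rec: _ => [|i v Pi Wv]; first by case: sW.
by apply: subspaceD => //; apply: WF.
Qed.

Lemma subspace_lincomb W n (a : 'rV_n) (v : 'I_n -> V) :
  subspace W -> (forall i, W (v i)) -> W (lincomb a v).
Proof. by move=> sW Wv; apply: subspace_sum => // i _; apply: subspaceZ. Qed.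

Lemma lincombD n (a b : 'rV_n) (v : 'I_n -> V) :
  lincomb (a + b) v = lincomb a v + lincomb b v.
Proof.
rewrite /lincomb -big_split /=; apply: eq_bigr => i _.
by rewrite mxE rmorphD scalerDl.
Qed.

Lemma lincombB n (a b : 'rV_n) (v : 'I_n -> V) :
  lincomb (a - b) v = lincomb a v - lincomb b v.
Proof.
rewrite /lincomb -sumrB; apply: eq_bigr => i _.
by rewrite !mxE rmorphB scalerBl.
Qed.

Lemma lincomb_mul m n (a : 'rV_m) (M : 'M_(m, n)) (v : 'I_n -> V) :
  lincomb (a *m M) v = lincomb a (fun i => lincomb (row i M) v).
Proof.
rewrite /lincomb; under eq_bigr => j _.
  rewrite mxE rmorph_sum scaler_suml; under eq_bigr => i _.
    by rewrite rmorphM -scalerA; over.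
  over.
rewrite exchange_big /=; apply: eq_bigr => i _; rewrite scaler_sumr.
by apply: eq_bigr => j _; rewrite mxE.
Qed.

Lemma lincombB_family n (a : 'rV_n) (v w : 'I_n -> V) :
  lincomb a v - lincomb a w = lincomb a (fun i => v i - w i).
Proof. by rewrite /lincomb -sumrB; apply: eq_bigr => i _; rewrite scalerBr. Qed.

Lemma qdim_zero U W : (forall u, U u -> W u) -> qdim U W 0.
Proof.
move=> UW; exists (fun=> 0); split=> [[]//|u /UW|a _]; last by apply/rowP => -[].
by exists 0; rewrite /lincomb big_ord0 subr0.
Qed.

Lemma qdim_zero_sub U W u : qdim U W 0 -> U u -> W u.
Proof. by case=> v [_ spv _] /spv[a]; rewrite /lincomb big_ord0 subr0. Qed.

(** In coordinates with respect to a basis of U / W, a basis of T / W is a row-free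
matrix M, and a basis of a complement of its row space represents U / T. *)
Lemma qdim_quotient U T W n b : subspace U -> subspace T -> subspace W ->
  (forall u, W u -> T u) -> (forall u, T u -> U u) ->
  qdim U W n -> qdim T W b -> (b <= n)%N /\ qdim U T (n - b).
Proof.
move=> sU sT sW WT TU [v [Uv spv frv]] [w [Tw spw frw]].
have /fin_all_exists [m mE] : forall i, exists a : 'rV_n, W (w i - lincomb a v).
  by move=> i; apply/spv/TU.
pose M := \matrix_i m i.
have Mmod (x : 'rV_b) : W (lincomb x w - lincomb (x *m M) v).
  rewrite lincomb_mul lincombB_family; apply: subspace_lincomb => // i.
  by rewrite rowK.
have Mfree : row_free M.
  apply: inj_row_free => x xM0; apply: frw.
  by have := Mmod x; rewrite xM0 /lincomb [X in _ - X]big1 ?subr0 // => i _;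
     rewrite mxE rmorph0 scale0r.
have rkM : \rank M = b by apply/eqP.
have rkC : \rank (M^C)%MS = (n - b)%N by rewrite mxrank_compl rkM.
split; first by rewrite -rkM rank_leq_col.
rewrite -rkC; pose C := row_base M^C%MS.
exists (fun i => lincomb (row i C) v); split=> [i|u Uu|y].
- exact: subspace_lincomb.
- have [a Wa] := spv _ Uu.
  have /sub_addsmxP [[x y] /= aE] : (a <= M + C)%MS.
    by rewrite (adds_eqmx (eqmx_refl M) (eq_row_base _)) submx_full // addsmx_compl_full.
  exists y; rewrite -lincomb_mul.
  have -> : u - lincomb (y *m C) v = (u - lincomb a v) -
      (lincomb x w - lincomb (x *m M) v) + lincomb x w.
    by rewrite aE lincombD opprB opprD !addrA addrNK [in RHS]addrAC addrNK.
  apply: subspaceD => //; last exact: subspace_lincomb.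
  by apply/WT; apply: subspaceB.
- rewrite -lincomb_mul => Ty; have [x Wx] := spw _ Ty.
  have /frv /eqP : W (lincomb (y *m C - x *m M) v).
    rewrite lincombB; have := subspaceD sW Wx (Mmod x).
    by rewrite addrA subrK.
  rewrite subr_eq0 => /eqP E.
  have : (y *m C <= M :&: M^C)%MS.
    rewrite sub_capmx {1}E submxMl /=.
    by rewrite (submx_trans (submxMl _ _)) // eq_row_base.
  rewrite capmx_compl submx0 => /eqP yC0.
  have := row_base_free M^C%MS; rewrite -/C => /row_freeP [D CD].
  by rewrite -[y]mulmx1 -CD mulmxA yC0 mul0mx.
Qed.

Lemma qdim_add U T W a b : subspace W ->
  (forall u, W u -> T u) -> (forall u, T u -> U u) -> subspace T ->
  qdim U T a -> qdim T W b -> qdim U W (a + b).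
Proof.
move=> sW WT TU sT [v [Uv spv frv]] [w [Tw spw frw]].
pose z i := match split i with inl i => v i | inr i => w i end.
have zE (x : 'rV_a) (y : 'rV_b) :
    lincomb (row_mx x y) z = lincomb x v + lincomb y w.
  rewrite /lincomb big_split_ord /=; congr (_ + _); apply: eq_bigr => i _.
    by rewrite row_mxEl /z (unsplitK (inl i)).
  by rewrite row_mxEr /z (unsplitK (inr i)).
exists z; split=> [i|u /spv[x Tx]|y].
- by rewrite /z; case: split => j //; apply/TU.
- have [y Wy] := spw _ Tx; exists (row_mx x y).
  by rewrite zE opprD addrA.
- rewrite -[y]hsubmxK zE => Wz; have y1 : lsubmx y = 0.
    apply: frv; rewrite -[lincomb _ v](addrK (lincomb (rsubmx y) w)).
    by apply: subspaceB => //; [apply: WT | apply: subspace_lincomb].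
  rewrite y1 (frw (rsubmx y)) ?row_mx0 //.
  by move: Wz; rewrite y1 /lincomb [X in X + _]big1 ?add0r // => i _;
     rewrite mxE rmorph0 scale0r.
Qed.

End QuotientDim.

(** Isomorphisms of quotients are given by linear correspondences, because the one
between the two descriptions of the Jacobian module is induced by no preferred map. *)
Lemma qdim_correspondence (K : fieldType)
    (A A' : nzRingType) (iota : {rmorphism K -> A}) (iota' : {rmorphism K -> A'})
    (V : lmodType A) (V' : lmodType A') (U W : V -> Prop) (U' W' : V' -> Prop)
    (E : V -> V' -> Prop) k :
  subspace iota U -> subspace iota' U' ->
  E 0 0 ->
  (forall a u v u' v', E u u' -> E v v' ->
     E (iota a *: u + v) (iota' a *: u' + v')) ->
  (forall u', U' u' -> exists2 u, U u & E u u') ->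
  (forall u, U u -> exists2 u', U' u' & E u u') ->
  (forall u u', U u -> U' u' -> E u u' -> (W u <-> W' u')) ->
  qdim iota' U' W' k -> qdim iota U W k.
Proof.
move=> sU sU' E0 El EU' EU EW [v' [Uv' spv' frv']].
have /fin_all_exists2 [v Uv Ev] : forall i, exists2 u, U u & E u (v' i).
  by move=> i; apply: EU'.
have ElM a : E (lincomb iota a v) (lincomb iota' a v').
  rewrite /lincomb; elim/big_rec2: _ => [|i y y' _ Ey]; first exact: E0.
  exact: El.
exists v; split=> // [u Uu|a Wa].
  have [u' Uu' Eu] := EU _ Uu; have [a Wa] := spv' _ Uu'.
  exists a; apply/(EW _ (u' - lincomb iota' a v')) => //.
  - by apply: (subspaceB sU) => //; apply: subspace_lincomb.
  - by apply: (subspaceB sU') => //; apply: subspace_lincomb.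
  have := El (-1) _ _ _ _ (ElM a) Eu.
  by rewrite !rmorphN1 !scaleN1r addrC [X in E _ X]addrC.
apply: frv'; apply/(EW (lincomb iota a v)) => //; exact: subspace_lincomb.
Qed.

(** * Homogeneous polynomials and monomial ideals *)
Section Grading.
Variables (K : fieldType) (n : nat).
Local Notation S := {mpoly K[n]}.
Implicit Types (p q : S) (m e : int).

(** Degrees are integers, so that shifted degrees need no side condition; only 0
is homogeneous of negative degree. *)
Definition ihomog m p : bool := if m is Posz k then p \is k.-homog else p == 0.

Definition ipart m p : S := if m is Posz k then pihomog mdeg k p else 0.

Lemma ihomog0 m : ihomog m 0.
Proof. by case: m => k /=; rewrite ?rpred0 ?eqxx. Qed.

Lemma ihomogD m p q : ihomog m p -> ihomog m q -> ihomog m (p + q).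
Proof.
case: m => k /=; first exact: rpredD.
by move=> /eqP -> /eqP ->; rewrite addr0.
Qed.

Lemma ihomogN m p : ihomog m p -> ihomog m (- p).
Proof. by case: m => k /=; rewrite ?rpredN ?oppr_eq0. Qed.

Lemma ihomogZ m a p : ihomog m p -> ihomog m (a *: p).
Proof.
case: m => k /=; first exact: rpredZ.
by move=> /eqP ->; rewrite scaler0.
Qed.

Lemma ihomogM m e p q : ihomog m p -> ihomog e q -> ihomog (m + e) (p * q).
Proof.
case: m => [k|k] /=; last by move=> /eqP ->; rewrite mul0r ihomog0.
case: e => [l|l] /=; last by move=> _ /eqP ->; rewrite mulr0 ihomog0.
exact: dhomogM.
Qed.

Lemma ihomog_uniq m e p : p != 0 -> ihomog m p -> ihomog e p -> m = e.
Proof.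
case: m => [k|k] /= p0; last by rewrite (negPf p0).
case: e => [l|l] /=; last by rewrite (negPf p0).
by move=> Hk Hl; rewrite (dhomog_uniq p0 Hk Hl).
Qed.

Lemma ihomogX i : ihomog 1 ('X_i : S).
Proof. by rewrite /= dhomogX; apply/eqP/mdeg1. Qed.

Lemma ihomogXn i N : ihomog N%:Z ('X_i ^+ N : S).
Proof. by rewrite /= mpolyXn dhomogX; apply/eqP; rewrite /= mdegMn mdeg1 mul1n. Qed.

Lemma ihomogC c : ihomog 0 (c%:MP : S).
Proof. by rewrite -[c%:MP]mulr1 mul_mpolyC; apply/ihomogZ/dhomog1. Qed.

Lemma ipartD m : {morph ipart m : p q / p + q}.
Proof. by case: m => k p q /=; rewrite ?raddfD ?addr0. Qed.

Lemma ipart0 m : ipart m 0 = 0.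
Proof. by case: m => k //=; rewrite raddf0. Qed.

Lemma ipartN m : {morph ipart m : p / - p}.
Proof. by case: m => k p /=; rewrite ?raddfN ?oppr0. Qed.

Lemma ipart_sum m I (r : seq I) (P : pred I) (F : I -> S) :
  ipart m (\sum_(i <- r | P i) F i) = \sum_(i <- r | P i) ipart m (F i).
Proof. exact: (big_morph _ (ipartD m) (ipart0 m)). Qed.

Lemma ihomog_ipart m p : ihomog m (ipart m p).
Proof. by case: m => k //=; apply: pihomogP. Qed.

Lemma ipart_id m p : ihomog m p -> ipart m p = p.
Proof. by case: m => k /=; [apply: pihomog_dE | move/eqP]. Qed.

Lemma ipart_ne m e p : ihomog e p -> e != m -> ipart m p = 0.
Proof.
case: m => [k|k]//=; case: e => [l|l] /=; last by move=> /eqP -> _; rewrite raddf0.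
by move=> H lk; apply: pihomog_ne0 H.
Qed.

Lemma ipart_decomp p : p = \sum_(k < msize p) ipart k%:Z p.
Proof. exact: pihomog_partitionE. Qed.

Lemma ipart_eq0 p : (forall m, ipart m p = 0) -> p = 0.
Proof. by move=> H; rewrite [p]ipart_decomp big1. Qed.

Lemma ipartM m e p q : ihomog e q -> ipart m (q * p) = q * ipart (m - e) p.
Proof.
move=> Hq; rewrite [in LHS](ipart_decomp p) [in RHS](ipart_decomp p).
rewrite mulr_sumr !ipart_sum mulr_sumr; apply: eq_bigr => k _.
have Hk := ihomog_ipart k p; have Hqk := ihomogM Hq Hk.
have [<-|NE] := eqVneq (e + k) m.
  by rewrite (ipart_id Hqk) addrAC subrr add0r (ipart_id Hk).
rewrite (ipart_ne Hqk) // (ipart_ne Hk) ?mulr0 //.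
by apply: contra_neq NE => ->; ring.
Qed.

Lemma ihomog_cancel m e p q : ihomog e q -> q != 0 ->
  ihomog (m + e) (q * p) -> ihomog m p.
Proof.
move=> Hq q0 H; have -> : p = ipart m p; last exact: ihomog_ipart.
apply: (mulfI q0); rewrite -{1}(ipart_id H) (ipartM _ _ Hq).
by congr (_ * ipart _ _); ring.
Qed.

Lemma X_neq0 (i : 'I_n) : ('X_i : S) != 0.
Proof. by apply/eqP => /(congr1 (mcoeff U_(i))); rewrite mcoeffX eqxx mcoeff0 => /eqP; rewrite oner_eq0. Qed.

Lemma Xn_neq0 (i : 'I_n) N : ('X_i ^+ N : S) != 0.
Proof. by rewrite expf_neq0 // X_neq0. Qed.

(** Taking i = k describes the principal ideal generated by a power of a variable. *)
Lemma monomial_ideal2 (i k : 'I_n) N p :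
  (forall m : 'X_{1..n}, m \in msupp p -> (N <= m i)%N || (N <= m k)%N) <->
  exists a b : S, p = 'X_i ^+ N * a + 'X_k ^+ N * b.
Proof.
have divX (m : 'X_{1..n}) j : (N <= m j)%N ->
    'X_[m] = 'X_j ^+ N * 'X_[m - U_(j) *+ N] :> S.
  move=> le; rewrite mpolyXn -mpolyXD addmC submK //.
  apply/mnm_lepP => l; rewrite mulmnE mnm1E.
  by case: eqP => [<-|]; rewrite ?mul1n ?mul0n.
split=> [H|[a [b ->]] m].
  rewrite (mpolyE p) big_seq; elim/big_rec: _ => [|m x /H /orP Hm [a [b ->]]].
    by exists (0 : S), (0 : S); rewrite !mulr0 addr0.
  case: Hm => /divX ->.
    exists (p@_m *: 'X_[m - U_(i) *+ N] + a), b.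
    by rewrite mulrDr -scalerAr addrA.
  exists a, (p@_m *: 'X_[m - U_(k) *+ N] + b).
  by rewrite mulrDr -scalerAr addrCA.
have suppX c j (m' : 'X_{1..n}) : m' \in msupp ('X_j ^+ N * c : S) -> (N <= m' j)%N.
  rewrite mulrC mpolyXn (perm_mem (msuppMX _ _)) => /mapP [l _ ->].
  by rewrite mnmDE mulmnE mnm1E eqxx mul1n leq_addr.
move=> /msuppD_le; rewrite mem_cat => /orP [] /suppX ->; by rewrite ?orbT.
Qed.

Lemma mem_msuppMXn (j : 'I_n) N p (m : 'X_{1..n}) : m \in msupp p ->
  (m + U_(j) *+ N)%MM \in msupp ('X_j ^+ N * p).
Proof.
move=> mp; rewrite mulrC mpolyXn (perm_mem (msuppMX _ _)); apply/mapP.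
by exists m => //; rewrite addmC.
Qed.

Lemma X_regular (i k : 'I_n) N (a b : S) : i != k ->
  'X_i ^+ N * a = 'X_k ^+ N * b ->
  exists c : S, a = 'X_k ^+ N * c /\ b = 'X_i ^+ N * c.
Proof.
move=> ik E.
have [|c [c' aE]] := (monomial_ideal2 k k N a).1.
  move=> m /(mem_msuppMXn i N); rewrite E => Hm.
  have := (monomial_ideal2 k k N ('X_k ^+ N * b)).2 _ _ Hm.
  rewrite mnmDE mulmnE mnm1E (negPf ik) mul0n addn0; apply.
  by exists b, (0 : S); rewrite mulr0 addr0.
exists (c + c'); rewrite mulrDr; split=> //.
by apply: (mulfI (Xn_neq0 k N)); rewrite -E aE; ring.
Qed.

(** Multiplication by a power of the third variable does not change the exponents
of the first two, which decide membership in the ideal. *)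
Lemma X_regular3 (i k l : 'I_n) N M (w a b : S) : i != l -> k != l ->
  'X_l ^+ M * w = 'X_i ^+ N * a + 'X_k ^+ N * b ->
  exists a' b' : S, w = 'X_i ^+ N * a' + 'X_k ^+ N * b'.
Proof.
move=> il kl E; apply/monomial_ideal2 => m /(mem_msuppMXn l M); rewrite E => Hm.
have := (monomial_ideal2 i k N ('X_i ^+ N * a + 'X_k ^+ N * b)).2 _ _ Hm.
rewrite !mnmDE !mulmnE !mnm1E ![l == _]eq_sym (negPf il) (negPf kl) !mul0n !addn0.
by apply; exists a, b.
Qed.

End Grading.

(** The only monomial of degree D in which neither 'X_i nor 'X_k occurs is the
D-th power of the third variable. *)
Lemma homog_mod_two_variables (K : fieldType) (i k l : 'I_3) D (p : {mpoly K[3]}) :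
  [set i; k; l] = [set: 'I_3] -> ihomog D%:Z p ->
  exists c a b, [/\ ihomog (D%:Z - 1) a, ihomog (D%:Z - 1) b &
    p = c *: 'X_l ^+ D + ('X_i * a + 'X_k * b)].
Proof.
move=> ikl Hp; suff [c [a [b E]]] : exists c a b,
    p = c *: 'X_l ^+ D + ('X_i * a + 'X_k * b).
  exists c, (ipart (D%:Z - 1) a), (ipart (D%:Z - 1) b).
  split; try exact: ihomog_ipart.
  rewrite -{1}(ipart_id Hp) E !ipartD !(ipartM _ _ (ihomogX _ _)).
  by rewrite (ipart_id (m := D%:Z)) //; apply/ihomogZ/ihomogXn.
exists p@_(U_(l) *+ D).
have [|a [b E]] := (monomial_ideal2 i k 1 (p - p@_(U_(l) *+ D) *: 'X_l ^+ D)).1; last first.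
  by exists a, b; rewrite -[p in LHS](subrK (p@_(U_(l) *+ D) *: 'X_l ^+ D)) E addrC.
move=> m; rewrite mcoeff_msupp mcoeffB mcoeffZ mpolyXn mcoeffX !lt0n -negb_and.
apply: contraNN => /andP [/eqP mi /eqP mk].
have [Dm|Dm] := eqVneq (mdeg m) D; last first.
  rewrite (dhomog_nemf_coeff Hp Dm).
  case: ((U_(l) *+ D)%MM =P m) Dm => [<-|_ _]; last by rewrite mulr0 subrr.
  by rewrite mdegMn mdeg1 mul1n eqxx.
suff -> : m = (U_(l) *+ D)%MM by rewrite eqxx mulr1 subrr.
have mj j : j != l -> m j = 0%N.
  move=> jl; have : j \in [set i; k; l] by rewrite ikl inE.
  by rewrite !inE (negPf jl) orbF => /orP [] /eqP ->.
apply/mnmP => j; rewrite mulmnE mnm1E eq_sym; case: eqVneq => [->|/mj -> //].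
rewrite mul1n -Dm mdegE (bigD1 l) //= big1 ?addn0 // => r /mj //.
Qed.

(** * Graded free modules *)
Section GradedVectors.
Variables (K : fieldType) (n : nat).
Local Notation S := {mpoly K[n]}.

Lemma ipart_sum_range (s : int) M (p : S) : s <= 0 -> (msize p)%:Z <= M%:Z + s ->
  \sum_(k < M) ipart (k%:Z + s) p = p.
Proof.
move=> s0 Mp; rewrite [RHS]ipart_decomp.
under eq_bigr => k _ do rewrite [X in ipart _ X]ipart_decomp ipart_sum.
rewrite exchange_big /=; apply: eq_bigr => d _.
have Hd : ihomog d%:Z (ipart d%:Z p) := ihomog_ipart _ _.
have ltM : (`|d%:Z - s| < M)%N by have := ltn_ord d; lia.
rewrite (bigD1 (Ordinal ltM)) //= big1 ?addr0 => [|k kne].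
  have -> : `|d%:Z - s|%:Z + s = d%:Z by lia.
  exact: ipart_id.
apply: ipart_ne Hd _; apply: contra_neq kne => E; apply: val_inj => /=; lia.
Qed.

Variable r : nat.
Implicit Types (delta : 'I_r -> int) (t e : int) (v w : 'rV[S]_r).

(** The part of degree t of the direct sum of the twisted modules S(delta i). *)
Definition vhomog delta t v : Prop := forall i, ihomog (t + delta i) (v 0 i).

Definition vpart delta t v : 'rV[S]_r := \row_i ipart (t + delta i) (v 0 i).

Lemma vhomog0 delta t : vhomog delta t 0.
Proof. by move=> i; rewrite mxE ihomog0. Qed.

Lemma vhomogD delta t v w : vhomog delta t v -> vhomog delta t w ->
  vhomog delta t (v + w).
Proof. by move=> Hv Hw i; rewrite mxE ihomogD. Qed.

Lemma vhomogZ delta t e (q : S) v : ihomog e q -> vhomog delta t v ->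
  vhomog delta (e + t) (q *: v).
Proof. by move=> Hq Hv i; rewrite mxE -addrA ihomogM. Qed.

Lemma vhomog_subspace delta t : subspace (@mpolyC n K) (vhomog delta t).
Proof.
split=> [|a v w Hv Hw]; first exact: vhomog0.
by apply: vhomogD => //; rewrite -[t]add0r; apply/vhomogZ => //; apply: ihomogC.
Qed.

Lemma vhomog_sum delta t I (s : seq I) (P : pred I) (F : I -> 'rV[S]_r) :
  (forall i, P i -> vhomog delta t (F i)) ->
  vhomog delta t (\sum_(i <- s | P i) F i).
Proof. exact: subspace_sum (vhomog_subspace delta t). Qed.

Lemma vhomog_neg delta t v : (forall i, t + delta i < 0) -> vhomog delta t v ->
  v = 0.
Proof.
move=> neg Hv; apply/rowP => i; rewrite mxE; apply/eqP.
by have := Hv i; have := neg i; case: (t + delta i).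
Qed.

Lemma vpartD delta t v w : vpart delta t (v + w) = vpart delta t v + vpart delta t w.
Proof. by apply/rowP => i; rewrite !mxE ipartD. Qed.

Lemma vpartN delta t v : vpart delta t (- v) = - vpart delta t v.
Proof. by apply/rowP => i; rewrite !mxE ipartN. Qed.

Lemma vpart0 delta t : vpart delta t 0 = 0.
Proof. by apply/rowP => i; rewrite !mxE ipart0. Qed.

Lemma vpart_sum delta t I (s : seq I) (P : pred I) (F : I -> 'rV[S]_r) :
  vpart delta t (\sum_(i <- s | P i) F i) = \sum_(i <- s | P i) vpart delta t (F i).
Proof. exact: (big_morph _ (vpartD delta t) (vpart0 delta t)). Qed.

Lemma vpartZ delta t e (q : S) v : ihomog e q ->
  vpart delta t (q *: v) = q *: vpart delta (t - e) v.
Proof.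
move=> Hq; apply/rowP => i; rewrite !mxE (ipartM _ _ Hq).
by congr (_ * ipart _ _); ring.
Qed.

Lemma vpart_scale delta t e (q : S) v : vhomog delta e v ->
  vpart delta t (q *: v) = ipart (t - e) q *: v.
Proof.
move=> Hv; apply/rowP => i; rewrite !mxE mulrC (ipartM _ _ (Hv i)) mulrC.
by congr (ipart _ _ * _); ring.
Qed.

Lemma vhomog_vpart delta t v : vhomog delta t (vpart delta t v).
Proof. by move=> i; rewrite mxE ihomog_ipart. Qed.

Lemma vpart_id delta t v : vhomog delta t v -> vpart delta t v = v.
Proof. by move=> Hv; apply/rowP => i; rewrite mxE ipart_id. Qed.

(** A vector is the sum of its homogeneous components; b bounds the degrees in
which they can be nonzero. *)
Lemma vpart_ind delta (P : 'rV[S]_r -> Prop) v :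
  P 0 -> (forall u w, P u -> P w -> P (u + w)) ->
  (forall t, P (vpart delta t v)) -> P v.
Proof.
move=> P0 PD Pv; pose b := (\sum_i (`|delta i| + msize (v 0%R i)))%N.
have bi i : (`|delta i| + msize (v 0%R i) <= b)%N.
  by rewrite /b (bigD1 i) //= leq_addr.
suff -> : v = \sum_(k < b + b) vpart delta (k%:Z - b%:Z) v.
  by elim/big_rec: _ => // k w _; apply: PD.
apply/rowP => i; rewrite summxE; under eq_bigr => k _ do rewrite mxE -addrA.
by rewrite ipart_sum_range //; have := bi i; lia.
Qed.

End GradedVectors.

Section GradedMatrices.
Variables (K : fieldType) (n r s : nat).
Local Notation S := {mpoly K[n]}.

(** The matrices of the degree-preserving maps between twisted free modules. *)
Definition mhomog (delta : 'I_r -> int) (eps : 'I_s -> int) (B : 'M[S]_(r, s)) :=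
  forall i j, ihomog (eps j - delta i) (B i j).

Lemma vpart_mul delta eps (B : 'M[S]_(r, s)) t (v : 'rV_r) :
  mhomog delta eps B -> vpart eps t (v *m B) = vpart delta t v *m B.
Proof.
move=> HB; apply/rowP => j; rewrite !mxE ipart_sum; apply: eq_bigr => i _.
rewrite mxE mulrC (ipartM _ _ (HB i j)) mulrC.
by congr (ipart _ _ * _); ring.
Qed.

Lemma vhomog_mul delta eps (B : 'M[S]_(r, s)) t (v : 'rV_r) :
  mhomog delta eps B -> vhomog delta t v -> vhomog eps t (v *m B).
Proof.
by move=> HB Hv; rewrite -(vpart_id Hv) -(vpart_mul _ _ HB); apply: vhomog_vpart.
Qed.

End GradedMatrices.

Section HilbertFunction.
Variable K : fieldType.
Local Notation S := {mpoly K[3]}.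

(** The Hilbert function of the polynomial ring in three variables. *)
Definition hdim (m : int) : nat := if m is Posz k then 'C(k + 2, k) else 0.

Lemma qdim_ihomog m :
  qdim (GRing.RMorphism.clone _ _ (@idfun K) _) (fun p : S => ihomog m p) (eq^~ 0) (hdim m).
Proof.
case: m => [k|k] /=; last first.
  by apply: qdim_zero => p /eqP.
have [f lf [g gK fK]] := @dhomog_vecaxiom 2 K k.
pose F : {linear dhomog 3 K k -> 'rV[K]_('C(k + 2, k))} :=
  HB.pack f (GRing.isLinear.Build _ _ _ _ f lf).
have sumE (a : 'rV[K]_('C(k + 2, k))) :
    lincomb (@idfun K) a (fun i => val (g (delta_mx 0 i))) = val (g a).
  rewrite /lincomb -[RHS]/(mpoly_of_dhomog (g a)).
  have -> : g a = \sum_i a 0 i *: g (delta_mx 0 i).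
    apply: (can_inj gK); rewrite fK -[f _]/(F _) linear_sum [LHS]row_sum_delta.
    by apply: eq_bigr => i _; rewrite linearZ /= fK.
  by rewrite linear_sum; apply: eq_bigr => i _; rewrite linearZ.
exists (fun i => val (g (delta_mx 0 i))); split=> [i|p Hp|a].
- exact: dhomog_is_dhomog.
- by exists (f (DHomog Hp)); rewrite sumE gK /= subrr.
- rewrite sumE => E.
  have /val_inj/(congr1 f) : val (g a) = val (0 : dhomog 3 K k) by exact: E.
  by rewrite fK -[f _]/(F _) linear0.
Qed.

(** Filter by the number of leading coordinates that may be nonzero; each step
contributes one homogeneous component of the polynomial ring. *)
Lemma qdim_vhomog r (delta : 'I_r -> int) t :
  qdim (@mpolyC 3 K) (vhomog delta t) (eq^~ 0) (\sum_i hdim (t + delta i)).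
Proof.
pose U k (v : 'rV[S]_r) := vhomog delta t v /\ forall i : 'I_r, (k <= i)%N -> v 0 i = 0.
have sU k : subspace (@mpolyC 3 K) (U k).
  have [h0 hl] : subspace (@mpolyC 3 K) (vhomog delta t) by apply: vhomog_subspace.
  split=> [|a u v [Hu u0] [Hv v0]]; first by split=> // i _; rewrite mxE.
  by split=> [|i ki]; [apply: hl | rewrite !mxE u0 // v0 // mulr0 addr0].
have s0 : subspace (@mpolyC 3 K) (eq^~ (0 : 'rV[S]_r)).
  by split=> // a u v -> ->; rewrite scaler0 addr0.
suff H k : (k <= r)%N -> qdim (@mpolyC 3 K) (U k) (eq^~ 0)
    (\sum_(i < r | (i < k)%N) hdim (t + delta i)).
  have [v [Uv spv frv]] := H r (leqnn r).
  rewrite (eq_bigl (fun i : 'I_r => (i < r)%N)) => [|i]; last by rewrite ltn_ord.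
  exists v; split=> // [i|u Hu]; first by case: (Uv i).
  by apply: spv; split=> // i; rewrite leqNgt ltn_ord.
elim: k => [|k IH] lek.
  rewrite big_pred0 //; apply: qdim_zero => v [_ v0].
  by apply/rowP => i; rewrite v0 ?mxE.
rewrite (bigD1 (Ordinal lek)) //= (eq_bigl (fun i : 'I_r => (i < k)%N)); last first.
  move=> i; rewrite ltnS leq_eqVlt -(inj_eq val_inj) /=.
  by case: ltngtP.
apply: (qdim_add (T := U k)) (IH (ltnW lek)) => //.
- by move=> u ->; case: (sU k).
- by move=> u [Hu u0]; split=> // i /ltnW/u0.
pose E (v : 'rV[S]_r) (p : S) := v 0 (Ordinal lek) = p.
apply: (qdim_correspondence (E := E)) (qdim_ihomog (t + delta (Ordinal lek))) => //.
- by split=> [|a u v Hu Hv]; [apply: ihomog0 | apply/ihomogD => //; apply: ihomogZ].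
- by rewrite /E mxE.
- by move=> a u v p q; rewrite /E !mxE => -> ->; rewrite mul_mpolyC.
- move=> p Hp; exists (p *: delta_mx 0 (Ordinal lek)); last by rewrite /E !mxE !eqxx mulr1.
  split=> i; rewrite !mxE eqxx /=.
    case: eqP => [->|_]; first by rewrite mulr1.
    by rewrite mulr0 ihomog0.
  by case: eqP => [->|_ _]; rewrite ?ltnn // mulr0.
- by move=> u [Hu _]; exists (u 0 (Ordinal lek)).
- move=> u p [Hu u0] _ <-; split=> [[_ H]|E0]; first exact: H.
  split=> // i; rewrite leq_eqVlt => /orP [/eqP ki|/u0 //].
  by rewrite -E0; congr (u 0 _); apply: val_inj.
Qed.

End HilbertFunction.

Lemma Posz_sum (I : finType) (f : I -> nat) :
  (\sum_i f i)%N%:Z = \sum_i (f i)%:Z.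
Proof. by rewrite -[LHS]natz natr_sum; apply: eq_bigr => i _; rewrite natz. Qed.

Section RankNullity.
Variables (K : fieldType) (n r s : nat).
Local Notation S := {mpoly K[n]}.
Variables (delta : 'I_r -> int) (eps : 'I_s -> int) (A : 'M[S]_(r, s)).
Local Notation sub := (subspace (@mpolyC n K)).

Definition ker_part t (v : 'rV[S]_r) := vhomog delta t v /\ v *m A = 0.

Definition im_part t (u : 'rV[S]_s) := vhomog eps t u /\ exists v, u = v *m A.

Lemma zero_subspace m : sub (eq^~ (0 : 'rV[S]_m)).
Proof. by split=> // a u v -> ->; rewrite scaler0 addr0. Qed.

Lemma ker_part_subspace t : sub (ker_part t).
Proof.
have [h0 hl] : sub (vhomog delta t) by apply: vhomog_subspace.
split=> [|a u v [Hu u0] [Hv v0]]; first by split; rewrite ?mul0mx.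
by split; [apply: hl | rewrite mulmxDl -scalemxAl u0 v0 scaler0 addr0].
Qed.

Lemma im_part_subspace t : sub (im_part t).
Proof.
have [h0 hl] : sub (vhomog eps t) by apply: vhomog_subspace.
split=> [|a u v [Hu [x xE]] [Hv [y yE]]].
  by split=> //; exists 0; rewrite mul0mx.
split; first exact: hl.
by exists (a%:MP *: x + y); rewrite mulmxDl -scalemxAl xE yE.
Qed.

Hypothesis A_homog : mhomog delta eps A.

Lemma im_partP t u : im_part t u <-> exists2 v, vhomog delta t v & u = v *m A.
Proof.
split=> [[Hu [v vE]]|[v Hv ->]]; last by split; [apply: vhomog_mul Hv | exists v].
exists (vpart delta t v); first exact: vhomog_vpart.
by rewrite -(vpart_id Hu) vE (vpart_mul _ _ A_homog).
Qed.

(** The bound b <= a makes the truncated difference a true one. *)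
Lemma rank_nullity t a b : qdim (@mpolyC n K) (vhomog delta t) (eq^~ 0) a ->
  qdim (@mpolyC n K) (ker_part t) (eq^~ 0) b ->
  (b <= a)%N /\ qdim (@mpolyC n K) (im_part t) (eq^~ 0) (a - b).
Proof.
move=> Ha Hb.
have [|||||lt Hq] := qdim_quotient _ _ _ _ _ Ha Hb.
- exact: vhomog_subspace.
- exact: ker_part_subspace.
- exact: zero_subspace.
- by move=> u ->; case: (ker_part_subspace t).
- by move=> u [].
split=> //; move: Hq; apply: (qdim_correspondence (E := fun u v => u = v *m A)).
- exact: im_part_subspace.
- exact: vhomog_subspace.
- by rewrite mul0mx.
- by move=> c u v u' v' -> ->; rewrite mulmxDl -scalemxAl.
- by move=> v Hv; exists (v *m A) => //; apply/im_partP; exists v.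
- by move=> u /im_partP [v Hv ->]; exists v.
- by move=> u v _ Hv ->; split=> [E|[]].
Qed.

End RankNullity.

(** * Third syzygy modules are free *)
Local Notation i0 := (@Ordinal 3 0 isT).
Local Notation i1 := (@Ordinal 3 1 isT).
Local Notation i2 := (@Ordinal 3 2 isT).

Lemma ord3_ind (P : 'I_3 -> Prop) : P i0 -> P i1 -> P i2 -> forall i, P i.
Proof.
move=> P0 P1 P2 [[|[|[|k]]] lt] //.
- by rewrite (_ : Ordinal lt = i0) //; apply: val_inj.
- by rewrite (_ : Ordinal lt = i1) //; apply: val_inj.
- by rewrite (_ : Ordinal lt = i2) //; apply: val_inj.
Qed.

(** The first four conditions say that M is a graded submodule.  The last two say
that the variables are regular on the quotient Q of the free module by M, and that
the first Tor of Q with S / ('X_0, 'X_1) vanishes.  Both hold when Q is the kernel of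
a map of free modules, that is, when M is a third syzygy module. *)
Record deep_submodule (K : fieldType) (r : nat) (delta : 'I_r -> int)
    (M : 'rV[{mpoly K[3]}]_r -> Prop) : Prop := DeepSubmodule {
  deep0 : M 0;
  deepD : forall v w, M v -> M w -> M (v + w);
  deepZ : forall (a : {mpoly K[3]}) v, M v -> M (a *: v);
  deep_vpart : forall t v, M v -> M (vpart delta t v);
  deep_saturated : forall i v, M ('X_i *: v) -> M v;
  deep_regular : forall v w, M ('X_i0 *: v + 'X_i1 *: w) ->
    exists v' w', [/\ M v', M w' &
      'X_i0 *: v + 'X_i1 *: w = 'X_i0 *: v' + 'X_i1 *: w'] }.

Section FreeModule.
Variables (K : fieldType) (r : nat) (delta : 'I_r -> int).
Local Notation S := {mpoly K[3]}.
Variable M : 'rV[S]_r -> Prop.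
Hypothesis delta_le0 : forall i, delta i <= 0.
Hypothesis M_deep : deep_submodule delta M.

Implicit Types (rho : nat -> 'rV[S]_r) (e : nat -> int).

Definition span m rho v := exists c : nat -> S, v = \sum_(l < m) c l *: rho l.

(** Each rho l has the least degree among the homogeneous elements of M outside
the span of its predecessors.  Such a family is a beginning of a minimal system of
generators, and can be built before M is known to be finitely generated. *)
Definition greedy_family m rho e := forall l, (l < m)%N ->
  [/\ M (rho l), vhomog delta (e l) (rho l), ~ span l rho (rho l) &
      forall t v, t < e l -> M v -> vhomog delta t v -> span l rho v].

Lemma span0 m rho : span m rho 0.
Proof. by exists (fun=> 0); rewrite big1 // => l _; rewrite scale0r. Qed.

Lemma spanD m rho v w : span m rho v -> span m rho w -> span m rho (v + w).
Proof.
move=> [c ->] [d ->]; exists (fun l => c l + d l); rewrite -big_split /=.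
by apply: eq_bigr => l _; rewrite scalerDl.
Qed.

Lemma spanZ m rho a v : span m rho v -> span m rho (a *: v).
Proof.
move=> [c ->]; exists (fun l => a * c l); rewrite scaler_sumr.
by apply: eq_bigr => l _; rewrite scalerA.
Qed.

Lemma spanW m k rho v : (m <= k)%N -> span m rho v -> span k rho v.
Proof.
move=> lemk [c ->]; exists (fun l => if (l < m)%N then c l else 0).
rewrite -(big_mkord xpredT (fun l => c l *: rho l)).
rewrite -(big_mkord xpredT (fun l => (if (l < m)%N then c l else 0) *: rho l)).
rewrite (big_cat_nat (n := m) (p := k)) //= [X in _ + X]big_nat_cond [X in _ + X]big1 ?addr0.
  by apply: eq_big_nat => i /andP [_ ->].
by move=> i /andP [/andP [mi _] _]; rewrite ltnNge mi scale0r.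
Qed.

Lemma M_sum m rho (c : nat -> S) : (forall l, (l < m)%N -> M (rho l)) ->
  M (\sum_(l < m) c l *: rho l).
Proof.
move=> Hm; elim/big_rec: _ => [|l v _]; first exact: (deep0 M_deep).
by apply: (deepD M_deep); apply: (deepZ M_deep); apply: Hm.
Qed.

Section GreedyFamily.
Variables (m : nat) (rho : nat -> 'rV[S]_r) (e : nat -> int).
Hypothesis rhoP : greedy_family m rho e.

Lemma greedy_neq0 l : (l < m)%N -> rho l != 0.
Proof.
by case/rhoP => _ _ + _; move=> H; apply/eqP => E; apply: H; rewrite E; apply: span0.
Qed.

Lemma greedy_degree_ge0 l : (l < m)%N -> 0 <= e l.
Proof.
move=> lm; have [_ Hl _ _] := rhoP lm; rewrite leNgt; apply/negP => el.
have := greedy_neq0 lm; rewrite (vhomog_neg _ Hl) ?eqxx // => i.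
by have := delta_le0 i; lia.
Qed.

Lemma greedy_degree_mono k l : (k < l)%N -> (l < m)%N -> e k <= e l.
Proof.
move=> kl lm; have [Ml Hl Nl _] := rhoP lm; have [_ _ _ Hk] := rhoP (ltn_trans kl lm).
rewrite leNgt; apply/negP => lt; apply: Nl; apply: spanW (ltnW kl) _.
exact: Hk lt Ml Hl.
Qed.

(** Restrict to the line 'X_0 = 'X_1 = 0, where homogeneous coefficients become
scalars times powers of 'X_2.  In a relation with a nonzero scalar, let l0 be the
last such index.  After division by a power of 'X_2 the relation exhibits an
element of M in ('X_0, 'X_1) S^r, hence in ('X_0, 'X_1) M; its coefficients in M have
degree less than e l0, so they lie in the span of the predecessors of rho l0, and
then so does rho l0. *)
Lemma greedy_restricted_independent (D : int) (gamma : nat -> K) (a : nat -> nat) u w :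
  (forall l, (l < m)%N -> gamma l != 0 -> (a l)%:Z + e l = D) ->
  \sum_(l < m) (gamma l *: 'X_i2 ^+ (a l) : S) *: rho l = 'X_i0 *: u + 'X_i1 *: w ->
  forall l, (l < m)%N -> gamma l = 0.
Proof.
move=> HD E l lm; apply/eqP; apply: contraT => gl.
have exP : exists k, (k < m)%N && (gamma k != 0) by exists l; rewrite lm.
have ubP k : (k < m)%N && (gamma k != 0) -> (k <= m)%N by case/andP => /ltnW.
case: (ex_maxnP exP ubP) => l0 /andP [l0m gl0] l0max {l lm gl exP ubP}.
have al k : (k < l0)%N -> gamma k != 0 -> (a l0 <= a k)%N.
  move=> kl gk; have := HD _ l0m gl0; have := HD _ (ltn_trans kl l0m) gk.
  by have := greedy_degree_mono kl l0m; lia.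
(* The coefficients after division by the least power of 'X_2 that occurs. *)
pose c k : S := if gamma k == 0 then 0 else gamma k *: 'X_i2 ^+ (a k - a l0).
pose v := \sum_(k < l0.+1) c k *: rho k.
have vE : 'X_i2 ^+ (a l0) *: v = 'X_i0 *: u + 'X_i1 *: w.
  rewrite -E -(big_mkord xpredT (fun l => (gamma l *: 'X_i2 ^+ (a l) : S) *: rho l)).
  rewrite (big_cat_nat (n := l0.+1)) //= [X in _ + X]big_nat_cond [X in _ + X]big1 ?addr0; last first.
    move=> k /andP [/andP [lk km] _]; have -> : gamma k = 0.
      apply/eqP; apply: contraLR lk => gk; rewrite -leqNgt.
      by apply: l0max; rewrite km gk.
    by rewrite !scale0r.
  rewrite big_mkord scaler_sumr; apply: eq_bigr => k _; rewrite scalerA; congr (_ *: _).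
  rewrite /c; case: eqVneq => [->|gk]; first by rewrite mulr0 scale0r.
  rewrite -scalerAr -exprD subnKC //; have := ltn_ord k; rewrite ltnS leq_eqVlt.
  by case/orP => [/eqP -> //|kl]; apply: al.
have Mv : M v by apply: M_sum => k kl; case: (rhoP (leq_trans kl l0m)).
have [v1 [v2 v12]] : exists v1 v2, v = 'X_i0 *: v1 + 'X_i1 *: v2.
  have /fin_all_exists [f1 /fin_all_exists [f2 fE]] : forall i, exists a b,
      v 0 i = 'X_i0 * a + 'X_i1 * b.
    move=> i; have /rowP/(_ i) := vE; rewrite !mxE.
    exact: (@X_regular3 _ _ i0 i1 i2 1).
  by exists (\row_i f1 i), (\row_i f2 i); apply/rowP => i; rewrite !mxE fE.
have [w1 [w2 [Mw1 Mw2 w12]]] : exists v' w', [/\ M v', M w' &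
    'X_i0 *: v1 + 'X_i1 *: v2 = 'X_i0 *: v' + 'X_i1 *: w'].
  by apply: (deep_regular M_deep); rewrite -v12.
have Hv : vhomog delta (e l0) v.
  apply: vhomog_sum => k _; rewrite /c; case: eqVneq => [_|gk].
    by rewrite scale0r; apply: vhomog0.
  have km : (k < m)%N by apply: leq_trans l0m; apply: ltn_ord.
  have [_ Hk _ _] := rhoP km.
  have -> : e l0 = (a k - a l0)%N%:Z + e k.
    have := HD _ l0m gl0; have := HD _ km gk.
    suff : (a l0 <= a k)%N by lia.
    have := ltn_ord k; rewrite ltnS leq_eqVlt.
    by case/orP => [/eqP -> //|kl]; apply: al.
  by apply: vhomogZ => //; apply/ihomogZ/ihomogXn.
have [_ _ Nl0 Hl0] := rhoP l0m.
have spv : span l0 rho v.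
  rewrite -(vpart_id Hv) v12 w12 vpartD !(vpartZ _ _ _ (ihomogX _ _)).
  apply: spanD; apply: spanZ.
    by apply: (Hl0 (e l0 - 1)); [lia|apply: (deep_vpart M_deep)|apply: vhomog_vpart].
  by apply: (Hl0 (e l0 - 1)); [lia|apply: (deep_vpart M_deep)|apply: vhomog_vpart].
case: Nl0; have -> : rho l0 = (gamma l0)^-1%:MP *: (v + (-1) *: \sum_(k < l0) c k *: rho k).
  rewrite /v big_ord_recr /= scaleN1r addrAC subrr add0r scalerA /c (negPf gl0).
  by rewrite subnn expr0 -mul_mpolyC mulr1 -mpolyCM mulVf // scale1r.
by apply: spanZ; apply: spanD => //; apply: spanZ; exists c.
Qed.

(** Independence modulo 'X_0.  By restriction to the line 'X_0 = 'X_1 = 0 the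
coefficients lie in ('X_0, 'X_1); dividing their 'X_1-parts by 'X_1 gives a relation
modulo 'X_0 of smaller degree.  The bound N on D drives the induction. *)
Lemma greedy_divisible N (D : int) (c : nat -> S) w : D < N%:Z ->
  (forall l, (l < m)%N -> ihomog (D - e l) (c l)) -> M w ->
  \sum_(l < m) c l *: rho l = 'X_i0 *: w ->
  forall l, (l < m)%N -> exists c', c l = 'X_i0 * c'.
Proof.
elim: N D c w => [|N IH] D c w DN Hc Mw E l lm.
  have := Hc _ lm; have := greedy_degree_ge0 lm.
  case De : (D - e l) => [k|k] /=; first by lia.
  by move=> _ /eqP ->; exists 0; rewrite mulr0.
have ikl : [set i0; i1; i2] = [set: 'I_3].
  by apply/setP => -[[|[|[|j]]] lt]; rewrite // !inE.
have /fin_all_exists [g /fin_all_exists [a /fin_all_exists [b gab]]] :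
    forall l : 'I_m, exists (g : K) (a b : S), [/\ ihomog (D - 1 - e l) a, ihomog (D - 1 - e l) b,
      c l = g *: 'X_i2 ^+ `|D - e l| + ('X_i0 * a + 'X_i1 * b) &
      g != 0 -> `|D - e l|%N%:Z + e l = D].
  move=> k; have := Hc _ (ltn_ord k).
  case De : (D - e k) => [j|j].
    move=> /(homog_mod_two_variables ikl) [g [a [b [Ha Hb ->]]]]; exists g, a, b.
    have -> : D - 1 - e k = j%:Z - 1 by lia.
    by split=> // _; lia.
  move=> /= /eqP ->; exists 0, 0, 0.
  by rewrite !ihomog0 scale0r !mulr0 !addr0 eqxx.
pose g' k := if insub k is Some i then g i else 0.
pose a' k := if insub k is Some i then a i else 0.
pose b' k := if insub k is Some i then b i else 0.
have {}gab k (km : (k < m)%N) : [/\ ihomog (D - 1 - e k) (a' k), ihomog (D - 1 - e k) (b' k),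
      c k = g' k *: 'X_i2 ^+ `|D - e k| + ('X_i0 * a' k + 'X_i1 * b' k) &
      g' k != 0 -> `|D - e k|%N%:Z + e k = D].
  by rewrite /g' /a' /b' insubT; apply: (gab (Ordinal km)).
have split_sum : \sum_(l < m) c l *: rho l =
    \sum_(l < m) (g' l *: 'X_i2 ^+ `|D - e l| : S) *: rho l +
    ('X_i0 *: (\sum_(l < m) a' l *: rho l) + 'X_i1 *: (\sum_(l < m) b' l *: rho l)).
  rewrite !scaler_sumr -!big_split /=; apply: eq_bigr => k _.
  by have [_ _ -> _] := gab _ (ltn_ord k); rewrite !scalerDl !scalerA.
set sa := \sum_(l < m) a' l *: rho l in split_sum.
set sb := \sum_(l < m) b' l *: rho l in split_sum.
have g0 : forall k, (k < m)%N -> g' k = 0.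
  apply: (@greedy_restricted_independent D g' (fun k => `|D - e k|%N) (w - sa) (- sb)).
    by move=> k km; case: (gab k km).
  by rewrite scalerBr scalerN -E split_sum -addrA -opprD addrK.
have E' : 'X_i1 *: sb = 'X_i0 *: (w - sa).
  rewrite scalerBr -E split_sum big1 ?add0r => [|k _]; last by rewrite g0 // !scale0r.
  by rewrite addrAC subrr add0r.
have Msa : M sa by apply: M_sum => k /rhoP [].
have [w' sbE wE] : exists2 w', sb = 'X_i0 *: w' & w - sa = 'X_i1 *: w'.
  have /fin_all_exists [f fE] : forall i, exists x,
      sb 0 i = 'X_i0 * x /\ (w - sa) 0 i = 'X_i1 * x.
    move=> i; apply: (@X_regular _ _ i1 i0 1) => //.
    by have /rowP/(_ i) := E'; rewrite !mxE.
  by exists (\row_i f i); apply/rowP => i; rewrite [RHS]mxE mxE; have [H1 H2] := fE i.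
have Mw' : M w'.
  apply: (deep_saturated M_deep (i := i1)); rewrite -wE; apply: (deepD M_deep) => //.
  by rewrite -scaleN1r; apply: (deepZ M_deep).
have [_ _ -> _] := gab _ lm.
have [||x ->] := IH (D - 1) b' w' _ _ Mw' sbE l lm; first by lia.
  by move=> k km; case: (gab k km).
by exists (a' l + 'X_i1 * x); rewrite g0 // scale0r; ring.
Qed.

(** Coefficients of a relation are divisible by 'X_0, and dividing them by it gives
a relation of smaller degree; below degree 0 they vanish. *)
Lemma greedy_independent_homog N (D : int) (c : nat -> S) : D < N%:Z ->
  (forall l, (l < m)%N -> ihomog (D - e l) (c l)) ->
  \sum_(l < m) c l *: rho l = 0 -> forall l, (l < m)%N -> c l = 0.
Proof.
elim: N D c => [|N IH] D c DN Hc E l lm.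
  have := Hc _ lm; have := greedy_degree_ge0 lm.
  by case De : (D - e l) => [k|k] /=; [lia | move=> _ /eqP].
have /fin_all_exists [x xE] : forall l : 'I_m, exists c', c l = 'X_i0 * c'.
  move=> k; have E0 : \sum_(l < m) c l *: rho l = 'X_i0 *: 0 by rewrite scaler0.
  exact: (greedy_divisible DN Hc (deep0 M_deep) E0 (ltn_ord k)).
pose x' k := if insub k is Some i then x i else 0.
have {}xE k : (k < m)%N -> c k = 'X_i0 * x' k.
  by move=> km; rewrite /x' insubT; apply: (xE (Ordinal km)).
rewrite xE // (IH (D - 1) x') ?mulr0 //; first by lia.
  move=> k km; apply: (ihomog_cancel (ihomogX K i0) (X_neq0 K i0)).
  have -> : D - 1 - e k + 1 = D - e k by ring.
  by rewrite -xE //; apply: Hc.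
apply/rowP => i; apply: (mulfI (X_neq0 K i0)).
have Ei : (\sum_(l < m) c l *: rho l) 0 i = 0 by rewrite E mxE.
rewrite [in RHS]mxE mulr0 -Ei !summxE mulr_sumr.
by apply: eq_bigr => k _; rewrite [in RHS]xE // !mxE mulrA.
Qed.

Lemma greedy_independent (c : nat -> S) :
  \sum_(l < m) c l *: rho l = 0 -> forall l, (l < m)%N -> c l = 0.
Proof.
move=> E l lm; apply: ipart_eq0 => t.
pose D := t + e l; pose d k := ipart (D - e k) (c k).
have -> : t = D - e l by rewrite /D addrK.
apply: (@greedy_independent_homog `|D|.+1 D d) => //; first by lia.
  by move=> k _; apply: ihomog_ipart.
transitivity (vpart delta D (\sum_(k < m) c k *: rho k)); last by rewrite E vpart0.
rewrite vpart_sum; apply: eq_bigr => k _.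
by have [_ Hk _ _] := rhoP (ltn_ord k); rewrite (vpart_scale _ _ Hk).
Qed.

End GreedyFamily.

Lemma eq_span m rho rho' v : (forall l, (l < m)%N -> rho l = rho' l) ->
  span m rho v <-> span m rho' v.
Proof.
by move=> E; split=> -[c ->]; exists c; apply: eq_bigr => l _; rewrite E.
Qed.

(** If the family does not span M, a homogeneous element of least degree outside
the span prolongs it. *)
Lemma greedy_extend m rho e : greedy_family m rho e ->
  (forall v, M v -> span m rho v) \/ exists rho' e', greedy_family m.+1 rho' e'.
Proof.
move=> rhoP; have [H|] := boolp.EM (forall v, M v -> span m rho v); first by left.
move=> /boolp.existsNP [v /boolp.not_implyP [Mv Nv]]; right.
have [t [w [Mw Hw Nw]]] : exists (t : nat) w, [/\ M w, vhomog delta t%:Z w & ~ span m rho w].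
  apply: boolp.contrapT => H; apply: Nv; apply: (@vpart_ind _ _ _ delta (span m rho)).
  - exact: span0.
  - exact: spanD.
  case=> k.
    apply: boolp.contrapT => Nk; apply: H; exists k, (vpart delta k v).
    by split=> //; [apply: (deep_vpart M_deep) | apply: vhomog_vpart].
  rewrite (vhomog_neg (t := Negz k) _ (vhomog_vpart _ _ _)); first exact: span0.
  by move=> i; have := delta_le0 i; lia.
elim/ltn_ind: t w Mw Hw Nw => t IH w Mw Hw Nw.
have [[t' [w' [tt' Mw' Hw' Nw']]]|H] := boolp.EM (exists (t' : nat) w',
    [/\ (t' < t)%N, M w', vhomog delta t'%:Z w' & ~ span m rho w']).
  exact: IH tt' _ Mw' Hw' Nw'.
pose rho' k := if k == m then w else rho k.
pose e' k := if k == m then t%:Z else e k.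
have E k : (k <= m)%N -> forall v, span k rho' v <-> span k rho v.
  move=> km u; apply: eq_span => l lk.
  by rewrite /rho' ltn_eqF // (leq_trans lk).
exists rho', e' => l; rewrite ltnS leq_eqVlt => /orP [/eqP ->|lm].
  rewrite /rho' /e' eqxx; split=> //; first by move=> /(E _ (leqnn m)).
  move=> t' u tt' Mu Hu; apply/(E _ (leqnn m)); case: t' tt' Hu => k tk Hu.
    by apply: boolp.contrapT => Nu; apply: H; exists k, u; split.
  rewrite (vhomog_neg _ Hu); first exact: span0.
  by move=> i; have := delta_le0 i; lia.
have [Ml Hl Nl Ll] := rhoP _ lm.
rewrite /rho' /e' (ltn_eqF lm); split=> //; first by move=> /(E _ (ltnW lm)).
by move=> t' u tt' Mu Hu; apply/(E _ (ltnW lm)); apply: Ll Mu Hu.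
Qed.

Lemma greedy_basis N : (forall rho e, ~ greedy_family N rho e) ->
  exists m rho e, [/\ (m < N)%N, greedy_family m rho e & forall v, M v -> span m rho v].
Proof.
elim: N => [|N IH] NN; first by case: (NN (fun=> 0) (fun=> 0)).
have [[rho [e G]]|H] := boolp.EM (exists rho e, greedy_family N rho e).
  case: (greedy_extend G) => [sp|[rho' [e' G']]]; first by exists N, rho, e.
  by case: (NN rho' e').
have [|m [rho [e [mN G sp]]]] := IH.
  by move=> rho e G; apply: H; exists rho, e.
by exists m, rho, e; split=> //; apply: ltnW.
Qed.

End FreeModule.

(** * Saturations of images of maps with isomorphic kernels *)
(** E is the graph of an isomorphism between the kernels of A and A'.  A relation
keeps the two kernels on an equal footing, so that each result below also holds
with A and A' exchanged. *)
Record kernel_iso (S : comNzRingType) (p q p' q' : nat) (A : 'M[S]_(p, q)) (A' : 'M[S]_(p', q'))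
    (E : 'rV[S]_p -> 'rV[S]_p' -> Prop) : Prop := KernelIso {
  iso_linear : forall a w g w' g', E w g -> E w' g' ->
    E (a *: w + w') (a *: g + g');
  iso_kernel_l : forall w g, E w g -> w *m A = 0;
  iso_kernel_r : forall w g, E w g -> g *m A' = 0;
  iso_total_l : forall w, w *m A = 0 -> exists g, E w g;
  iso_total_r : forall g, g *m A' = 0 -> exists w, E w g;
  iso_inj_l : forall w, E w 0 -> w = 0;
  iso_inj_r : forall g, E 0 g -> g = 0 }.

Lemma kernel_iso_sym (S : comNzRingType) p q p' q' (A : 'M[S]_(p, q)) (A' : 'M[S]_(p', q'))
    (E : 'rV[S]_p -> 'rV[S]_p' -> Prop) :
  kernel_iso A A' E -> kernel_iso A' A (fun g w => E w g).
Proof.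
case=> lin kl kr tl tr il ir; split=> //.
- by move=> a w g w' g'; apply: lin.
- by move=> w g; apply: kr.
- by move=> w g; apply: kl.
Qed.

Section ScaleIdentities.
Variables (A : comNzRingType) (r : nat).
Implicit Types (a b c : A) (u v w x : 'rV[A]_r).

Lemma koszul_cocycle a b c u v w :
  c *: (b *: u - a *: v) - b *: (c *: u - a *: w) + a *: (c *: v - b *: w) = 0.
Proof. by apply/rowP => l; rewrite !mxE; ring. Qed.

Lemma scale_diff_linear a b c u v w x :
  a *: (c *: u + v) - b *: (c *: w + x) = c *: (a *: u - b *: w) + (a *: v - b *: x).
Proof. by apply/rowP => l; rewrite !mxE; ring. Qed.

Lemma scale_diff_sub a b u v w x :
  a *: (u - v) - b *: (w - x) = (a *: u - b *: w) - (a *: v - b *: x).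
Proof. by apply/rowP => l; rewrite !mxE; ring. Qed.

Lemma scale_diff_shift a b u v w :
  a *: u - b *: v = a *: (u - b *: w) - b *: (v - a *: w).
Proof. by apply/rowP => l; rewrite !mxE; ring. Qed.

Lemma scale_diff_raise a b c (d : A) u v :
  (c * a) *: (d *: u) - (d * b) *: (c *: v) = (d * c) *: (a *: u - b *: v).
Proof. by apply/rowP => l; rewrite !mxE; ring. Qed.

Lemma koszul_shift a b c u v w x :
  b *: (c *: u - w) - a *: (c *: v - x) =
  c *: (b *: u - a *: v) - (a *: (- x) + b *: w).
Proof. by apply/rowP => l; rewrite !mxE; ring. Qed.

End ScaleIdentities.

Section Torsors.
Variables (K : fieldType) (p q p' q' : nat).
Local Notation S := {mpoly K[3]}.
Variables (A : 'M[S]_(p, q)) (A' : 'M[S]_(p', q')).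
Variable E : 'rV[S]_p -> 'rV[S]_p' -> Prop.
Local Notation Xp i n := ('X_i ^+ n : S).

(** On the open set where 'X_i is invertible, a i / 'X_i ^ n and v i / 'X_i ^ n are
preimages of x and u.  On the overlaps, the differences of these local preimages
form cocycles in the kernels of A and A'; x and u are related when the isomorphism
exchanges the two cocycles. *)
Definition related_at n (x : 'rV[S]_q) (u : 'rV[S]_q') :=
  exists (a : 'I_3 -> 'rV[S]_p) (v : 'I_3 -> 'rV[S]_p'),
    [/\ forall i, Xp i n *: x = a i *m A, forall i, Xp i n *: u = v i *m A' &
        forall i k, E (Xp k n *: a i - Xp i n *: a k) (Xp k n *: v i - Xp i n *: v k)].

Definition related x u := exists n, related_at n x u.

Hypothesis iso : kernel_iso A A' E.

Lemma iso0 : E 0 0.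
Proof.
have [|g Eg] := iso_total_l iso (w := 0); first by rewrite mul0mx.
by rewrite -[X in E _ X](iso_inj_r iso Eg).
Qed.

Lemma isoZ a w g : E w g -> E (a *: w) (a *: g).
Proof. by move=> H; have := iso_linear iso a H iso0; rewrite !addr0. Qed.

Lemma isoD w g w' g' : E w g -> E w' g' -> E (w + w') (g + g').
Proof. by move=> H H'; have := iso_linear iso 1 H H'; rewrite !scale1r. Qed.

Lemma isoB w g w' g' : E w g -> E w' g' -> E (w - w') (g - g').
Proof.
by move=> H H'; have := iso_linear iso (-1) H' H; rewrite !scaleN1r ![- _ + _]addrC.
Qed.

Lemma iso_unique_r w g g' : E w g -> E w g' -> g = g'.
Proof.
move=> H H'; apply/eqP; rewrite -subr_eq0; apply/eqP/(iso_inj_r iso).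
by rewrite -(subrr w); apply: isoB.
Qed.

Lemma related_at_raise n m x u : related_at n x u -> related_at (m + n) x u.
Proof.
move=> [a [v [aE vE Eav]]]; exists (fun i => Xp i m *: a i), (fun i => Xp i m *: v i).
split=> [i|i|i k]; first by rewrite exprD -scalerA aE -scalemxAl.
  by rewrite exprD -scalerA vE -scalemxAl.
by rewrite !exprD !scale_diff_raise; apply: isoZ.
Qed.

Lemma related0 : related 0 0.
Proof.
exists 0%N, (fun=> 0), (fun=> 0); split=> [i|i|i k]; rewrite ?mul0mx !scaler0 //.
by rewrite !subrr; apply: iso0.
Qed.

Lemma related_linear b x u y w : related x u -> related y w ->
  related (b *: x + y) (b *: u + w).
Proof.
move=> [n Hx] [m Hy]; exists (m + n)%N.
have {Hx} [a [v [aE vE Eav]]] := related_at_raise m Hx.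
have {Hy} := related_at_raise n Hy; rewrite addnC => -[a' [v' [aE' vE' Eav']]].
exists (fun i => b *: a i + a' i), (fun i => b *: v i + v' i); split=> [i|i|i k].
- by rewrite mulmxDl -scalemxAl -aE -aE'; apply/rowP => l; rewrite !mxE; ring.
- by rewrite mulmxDl -scalemxAl -vE -vE'; apply/rowP => l; rewrite !mxE; ring.
by rewrite 2!scale_diff_linear; apply: (iso_linear iso).
Qed.

Lemma scale_X_regular (i k : 'I_3) n (r : nat) (a b : 'rV[S]_r) : i != k ->
  Xp i n *: a = Xp k n *: b -> exists c, a = Xp k n *: c /\ b = Xp i n *: c.
Proof.
move=> ik ab; have /fin_all_exists [c cE] : forall l, exists c,
    a 0 l = Xp k n * c /\ b 0 l = Xp i n * c.
  by move=> l; apply: X_regular => //; have /rowP/(_ l) := ab; rewrite !mxE.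
exists (\row_l c l); split; apply/rowP => l; rewrite !mxE; by case: (cE l).
Qed.

Lemma scale_X_inj (i : 'I_3) n (r : nat) (a b : 'rV[S]_r) :
  Xp i n *: a = Xp i n *: b -> a = b.
Proof.
move=> /rowP ab; apply/rowP => l; apply: (mulfI (Xn_neq0 K i n)).
by have := ab l; rewrite !mxE.
Qed.

(** The cocycle of u is transported to the kernel of A.  As the powers of the
variables form a regular sequence, it is the coboundary of some a i in the free
module, and the images of the a i glue to an element x. *)
Lemma related_exists n u (v : 'I_3 -> 'rV[S]_p') :
  (forall i, Xp i n *: u = v i *m A') -> exists x, related_at n x u.
Proof.
move=> vE; pose g i k := Xp k n *: v i - Xp i n *: v k.
have gK i k : g i k *m A' = 0.
  by rewrite /g mulmxBl -!scalemxAl -!vE !scalerA mulrC subrr.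
have [w01 E01] := iso_total_r iso (gK i0 i1).
have [w02 E02] := iso_total_r iso (gK i0 i2).
have [w12 E12] := iso_total_r iso (gK i1 i2).
(* The cocycle condition, transported by the injectivity of the isomorphism. *)
have cocycle : Xp i2 n *: w01 = Xp i0 n *: (- w12) + Xp i1 n *: w02.
  have : Xp i2 n *: w01 - Xp i1 n *: w02 + Xp i0 n *: w12 = 0.
    apply: (iso_inj_l iso).
    have <- : Xp i2 n *: g i0 i1 - Xp i1 n *: g i0 i2 + Xp i0 n *: g i1 i2 = 0.
      exact: koszul_cocycle.
    by apply: isoD; [apply: isoB|]; apply: isoZ.
  move=> H; apply/eqP; rewrite -subr_eq0 -H; apply/eqP.
  by rewrite opprD scalerN opprK addrA [LHS]addrAC.
have [b [c w01E]] : exists b c, w01 = Xp i0 n *: b + Xp i1 n *: c.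
  have /fin_all_exists [b /fin_all_exists [c bcE]] : forall l, exists b c,
      w01 0 l = Xp i0 n * b + Xp i1 n * c.
    move=> l; have /rowP/(_ l) := cocycle; rewrite !mxE.
    exact: X_regular3.
  by exists (\row_l b l), (\row_l c l); apply/rowP => l; rewrite !mxE bcE.
(* On the overlap of the charts 0 and 1 the cocycle is already a coboundary. *)
pose a0 := c; pose a1 := - b.
have w01E' : w01 = Xp i1 n *: a0 - Xp i0 n *: a1.
  by rewrite w01E /a0 /a1 scalerN opprK addrC.
have [|a2 [A2 A2']] := @scale_X_regular i1 i0 n _ (Xp i2 n *: a0 - w02) (Xp i2 n *: a1 - w12) isT.
  have /eqP := cocycle; rewrite w01E' -subr_eq0 => H; apply/eqP.
  by rewrite -subr_eq0 koszul_shift.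
have [|x [x1 x0]] := @scale_X_regular i1 i0 n _ (a0 *m A) (a1 *m A) isT.
  have := iso_kernel_l iso E01; rewrite w01E' mulmxBl -!scalemxAl => /eqP.
  by rewrite subr_eq0 => /eqP.
have x2 : Xp i2 n *: x = a2 *m A.
  have := iso_kernel_l iso E02; have -> : w02 = Xp i2 n *: a0 - Xp i0 n *: a2.
    by rewrite -A2 opprB addrC subrK.
  rewrite mulmxBl -!scalemxAl x1 => /eqP; rewrite subr_eq0 => /eqP.
  by rewrite scalerA mulrC -scalerA => /scale_X_inj.
pose a (i : 'I_3) := if i == i0 then a0 else if i == i1 then a1 else a2.
exists x, a, v; have Ea i k : E (Xp k n *: a i - Xp i n *: a k) (g i k) ->
    E (Xp i n *: a k - Xp k n *: a i) (g k i).
  move=> H; have := isoZ (-1) H; rewrite !scaleN1r !opprB.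
  by congr (E _ _); rewrite /g opprB.
have H01 : E (Xp i1 n *: a i0 - Xp i0 n *: a i1) (g i0 i1) by rewrite /a /= -w01E'.
have H02 : E (Xp i2 n *: a i0 - Xp i0 n *: a i2) (g i0 i2).
  by rewrite /a /= -A2 opprB addrC subrK.
have H12 : E (Xp i2 n *: a i1 - Xp i1 n *: a i2) (g i1 i2).
  by rewrite /a /= -A2' opprB addrC subrK.
have g0 i : E (Xp i n *: a i - Xp i n *: a i) (g i i) by rewrite /g !subrr; exact: iso0.
split; [ | exact: vE | ].
  by apply: ord3_ind; rewrite /a /=.
have Ei i k : E (Xp k n *: a i - Xp i n *: a k) (g i k).
  by elim/ord3_ind: i; elim/ord3_ind: k;
    [exact: g0 | exact: H01 | exact: H02 | exact: Ea H01 | exact: g0 | exact: H12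
    | exact: Ea H02 | exact: Ea H12 | exact: g0].
exact: Ei.
Qed.

(** Subtracting a global preimage a' of x turns the a i into elements of the
kernel of A; their partners h i correct the v i to local preimages of u that agree
on overlaps. *)
Lemma related_image x u : related x u ->
  (exists a, x = a *m A) -> exists v, u = v *m A'.
Proof.
move=> [n [a [v [aE vE Eav]]]] [a' xE].
have hK i : (a i - Xp i n *: a') *m A = 0.
  by rewrite mulmxBl -scalemxAl -xE aE subrr.
have [h0 Eh0] := iso_total_l iso (hK i0).
have [h1 Eh1] := iso_total_l iso (hK i1).
have H : Xp i1 n *: (v i0 - h0) = Xp i0 n *: (v i1 - h1).
  apply/eqP; rewrite -subr_eq0; apply/eqP.
  have -> : Xp i1 n *: (v i0 - h0) - Xp i0 n *: (v i1 - h1) =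
     (Xp i1 n *: v i0 - Xp i0 n *: v i1) - (Xp i1 n *: h0 - Xp i0 n *: h1).
    exact: scale_diff_sub.
  apply/eqP; rewrite subr_eq0; apply/eqP; apply: (iso_unique_r (Eav i0 i1)).
  have -> : Xp i1 n *: a i0 - Xp i0 n *: a i1 =
     Xp i1 n *: (a i0 - Xp i0 n *: a') - Xp i0 n *: (a i1 - Xp i1 n *: a').
    exact: scale_diff_shift.
  by apply: isoB; apply: isoZ.
have [w [wE _]] := scale_X_regular (isT : i1 != i0) H.
exists w; apply: (@scale_X_inj i0 n); rewrite scalemxAl -wE mulmxBl -vE.
by rewrite (iso_kernel_r iso Eh0) subr0.
Qed.

Variables (delta : 'I_p -> int) (eps : 'I_q -> int).
Variables (delta' : 'I_p' -> int) (eps' : 'I_q' -> int) (s : int).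
Hypothesis A_homog : mhomog delta eps A.
Hypothesis A'_homog : mhomog delta' eps' A'.
Hypothesis E_homog : forall t w g, E w g ->
  E (vpart delta t w) (vpart delta' (t - s) g).

Lemma related_vpart t x u : related x u -> related (vpart eps t x) (vpart eps' (t - s) u).
Proof.
move=> [n [a [v [aE vE Eav]]]]; exists n.
exists (fun i => vpart delta (t + n%:Z) (a i)), (fun i => vpart delta' (t - s + n%:Z) (v i)).
have XH (i : 'I_3) := ihomogXn K i n.
split=> [i|i|i k].
- rewrite -(vpart_mul _ _ A_homog) -aE (vpartZ _ _ _ (XH i)).
  by congr (_ *: vpart _ _ _); ring.
- rewrite -(vpart_mul _ _ A'_homog) -vE (vpartZ _ _ _ (XH i)).
  by congr (_ *: vpart _ _ _); ring.
have := E_homog (t + n%:Z + n%:Z) (Eav i k).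
rewrite !vpartD !vpartN !(vpartZ _ _ _ (XH _)).
have -> : t + n%:Z + n%:Z - n%:Z = t + n%:Z by ring.
by have -> : t + n%:Z + n%:Z - s - n%:Z = t - s + n%:Z by ring.
Qed.

End Torsors.

Lemma related_sym (K : fieldType) p q p' q' (A : 'M[{mpoly K[3]}]_(p, q)) (A' : 'M_(p', q'))
    E x u : related A A' E x u <-> related A' A (fun g w => E w g) u x.
Proof. by split=> -[n [a [v [aE vE Eav]]]]; exists n, v, a. Qed.

(** * The pairing of syzygies *)
Local Notation j0 := (@Ordinal 4 0 isT).
Local Notation j1 := (@Ordinal 4 1 isT).
Local Notation j2 := (@Ordinal 4 2 isT).
Local Notation j3 := (@Ordinal 4 3 isT).

Lemma ord4_ind (P : 'I_4 -> Prop) : P j0 -> P j1 -> P j2 -> P j3 -> forall i, P i.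
Proof.
move=> P0 P1 P2 P3 [[|[|[|[|k]]]] lt] //.
- by rewrite (_ : Ordinal lt = j0) //; apply: val_inj.
- by rewrite (_ : Ordinal lt = j1) //; apply: val_inj.
- by rewrite (_ : Ordinal lt = j2) //; apply: val_inj.
- by rewrite (_ : Ordinal lt = j3) //; apply: val_inj.
Qed.

Lemma sum3 (V : nmodType) (F : 'I_3 -> V) : \sum_i F i = F i0 + F i1 + F i2.
Proof.
rewrite !big_ord_recl big_ord0 addr0 addrA.
by congr (F _ + F _ + F _); apply: val_inj.
Qed.

Lemma sum4 (V : nmodType) (F : 'I_4 -> V) : \sum_i F i = F j0 + F j1 + F j2 + F j3.
Proof.
rewrite !big_ord_recl big_ord0 addr0 !addrA.
by congr (F _ + F _ + F _ + F _); apply: val_inj.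
Qed.

Section Cross.
Variable A : comNzRingType.
Implicit Types u v w : 'rV[A]_3.

Definition cross u v (k : 'I_3) : A :=
  match val k with
  | 0%N => u 0 i1 * v 0 i2 - u 0 i2 * v 0 i1
  | 1%N => u 0 i2 * v 0 i0 - u 0 i0 * v 0 i2
  | _ => u 0 i0 * v 0 i1 - u 0 i1 * v 0 i0
  end.

Lemma crossC u v k : cross v u k = - cross u v k.
Proof. by elim/ord3_ind: k; rewrite /cross /=; ring. Qed.

Lemma crossxx u k : cross u u k = 0.
Proof. by elim/ord3_ind: k; rewrite /cross /=; ring. Qed.

Lemma cross_mul n (x : 'rV[A]_n) (G : 'M_(n, 3)) w k :
  cross (x *m G) w k = \sum_i x 0 i * cross (row i G) w k.
Proof.
elim/ord3_ind: k; rewrite /cross /= !mxE !mulr_suml -sumrB;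
  by apply: eq_bigr => i _; rewrite !mxE; ring.
Qed.

Lemma cross_mul_r n (x : 'rV[A]_n) (G : 'M_(n, 3)) w k :
  cross w (x *m G) k = \sum_i x 0 i * cross w (row i G) k.
Proof.
rewrite crossC cross_mul -sumrN; apply: eq_bigr => i _.
by rewrite [cross w _ _]crossC mulrN.
Qed.

Lemma cross_linear_r a u v w k :
  cross u (a *: v + w) k = a * cross u v k + cross u w k.
Proof. by elim/ord3_ind: k; rewrite /cross /= !mxE; ring. Qed.

End Cross.

(** F stands for the gradient of the curve. *)
Section Syzygies.
Variable K : fieldType.
Local Notation S := {mpoly K[3]}.
Variables (F : 'cV[S]_3) (N : int).
Hypothesis F_homog : forall k, ihomog N (F k 0).
Hypothesis F_neq0 : exists k, F k 0 != 0.
Hypothesis F_primitive : forall p : S, prime_elt p -> ~ forall k, divides p (F k 0).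

Definition syzygy (w : 'rV[S]_3) := w *m F = 0.

Lemma syzygyE w : syzygy w <-> w 0 i0 * F i0 0 + w 0 i1 * F i1 0 + w 0 i2 * F i2 0 = 0.
Proof.
split=> [/matrixP/(_ 0 0)|E]; first by rewrite !mxE sum3.
by apply/matrixP => a b; rewrite !ord1 !mxE sum3.
Qed.

Lemma mul_F_inj (a b : S) : (forall k, a * F k 0 = b * F k 0) -> a = b.
Proof. by have [k Fk] := F_neq0 => /(_ k); apply: mulIf. Qed.

(** Vectors parallel to F are multiples of it, as F has no common factor. *)
Lemma parallel_multiple (a : 'I_3 -> S) :
  (forall i k, a i * F k 0 = a k * F i 0) -> exists h, forall k, a k = h * F k 0.
Proof.
move=> par; have [k0 Fk0] := F_neq0.
have [|h [_ hE]] := cancel_coprime (@factorial_mpoly K 3) Fk0 F_primitive (a := a) (b := a k0).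
  by move=> i; rewrite mulrC par.
by exists h.
Qed.

(** Both vectors are orthogonal to F, so their cross product is parallel to F. *)
Lemma cross_syzygies u v : syzygy u -> syzygy v ->
  exists h, forall k, cross u v k = h * F k 0.
Proof.
move=> /syzygyE Du /syzygyE Dv; apply: parallel_multiple => i k.
apply/eqP; rewrite -subr_eq0; apply/eqP.
(* Each difference lies in the ideal generated by the two orthogonality relations. *)
set Eu := (X in X = 0) in Du; set Ev := (X in X = 0) in Dv.
have H i' k' : exists x y, cross u v i' * F k' 0 - cross u v k' * F i' 0 =
    x * Eu + y * Ev.
  rewrite /Eu /Ev; elim/ord3_ind: i'; elim/ord3_ind: k'; rewrite /cross /=.
  - by exists 0, 0; ring.
  - by exists (v 0 i2), (- u 0 i2); ring.
  - by exists (- v 0 i1), (u 0 i1); ring.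
  - by exists (- v 0 i2), (u 0 i2); ring.
  - by exists 0, 0; ring.
  - by exists (v 0 i0), (- u 0 i0); ring.
  - by exists (v 0 i1), (- u 0 i1); ring.
  - by exists (- v 0 i0), (u 0 i0); ring.
  - by exists 0, 0; ring.
by have [x [y ->]] := H i k; rewrite Du Dv !mulr0 addr0.
Qed.

(** Cross products of the unit vectors with F. *)
Definition koszul (k : 'I_3) : 'rV[S]_3 := \row_i
  match val k, val i with
  | 0%N, 1%N => - F i2 0
  | 0%N, 2%N => F i1 0
  | 1%N, 0%N => F i2 0
  | 1%N, 2%N => - F i0 0
  | 2%N, 0%N => - F i1 0
  | 2%N, 1%N => F i0 0
  | _, _ => 0
  end.

Lemma koszul_syzygy k : syzygy (koszul k).
Proof. by apply/syzygyE; elim/ord3_ind: k; rewrite !mxE /=; ring. Qed.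

(** The triple product expansion, for w orthogonal to F. *)
Lemma cross_koszul k w l : syzygy w -> cross (koszul k) w l = w 0 k * F l 0.
Proof.
move=> /syzygyE Dw; apply/eqP; rewrite -subr_eq0; apply/eqP.
set E := (X in X = 0) in Dw.
suff [x ->] : exists x, cross (koszul k) w l - w 0 k * F l 0 = x * E by rewrite Dw mulr0.
rewrite /E; elim/ord3_ind: k; elim/ord3_ind: l; rewrite /cross /= !mxE /=.
all: try by exists 0; ring.
all: by exists (-1); ring.
Qed.

Variables (r : 'I_4 -> 'rV[S]_3) (d : 'I_4 -> int).
Let G : 'M[S]_(4, 3) := \matrix_i r i.
Hypothesis r_gen : forall w, syzygy w <-> exists c : 'rV_4, w = c *m G.
Hypothesis r_homog : forall i, vhomog (fun=> 0) (d i) (r i).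
Hypothesis r_minimal : forall i (c : 'rV_4), r i = c *m G -> c 0 i = 0 -> False.
Hypothesis d_ge0 : forall i, 0 <= d i.
Hypothesis d_sorted : [/\ d j0 <= d j1, d j1 <= d j2 & d j2 <= d j3].

Lemma r_syzygy i : syzygy (r i).
Proof. by apply/r_gen; exists (delta_mx 0 i); rewrite -rowE rowK. Qed.

Lemma r_neq0 i : r i != 0.
Proof.
by apply/eqP => ri0; apply: (r_minimal (i := i) (c := 0)); rewrite ?ri0 ?mul0mx ?mxE.
Qed.

Lemma G_homog : mhomog (fun i => - d i) (fun=> 0) G.
Proof. by move=> i j; rewrite mxE opprK add0r -[d i]addr0; apply: r_homog. Qed.

Lemma vpart_syzygy t w : syzygy w -> syzygy (vpart (fun=> 0) t w).
Proof.
move=> Dw; have FH : mhomog (fun=> 0) (fun=> N) F.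
  by move=> i j; rewrite ord1 subr0.
by rewrite /syzygy -(vpart_mul _ _ FH) Dw vpart0.
Qed.

Lemma syzygy_low_degree t w : syzygy w -> vhomog (fun=> 0) t w -> t < d j0 -> w = 0.
Proof.
move=> /r_gen [c cE] Hw td; rewrite -(vpart_id Hw) cE (vpart_mul _ _ G_homog).
rewrite (vhomog_neg _ (vhomog_vpart _ _ _)) ?mul0mx // => i.
suff : d j0 <= d i by lia.
by case: d_sorted => *; elim/ord4_ind: i; lia.
Qed.

Lemma ipart_msize m (p : S) : (msize p)%:Z <= m -> ipart m p = 0.
Proof.
move=> pm; rewrite [p]ipart_decomp ipart_sum big1 // => k _.
by apply: ipart_ne (ihomog_ipart _ _) _; apply/eqP => E; have := ltn_ord k; lia.
Qed.

Lemma prime_msize (p : S) : prime_elt p -> (1 < msize p)%N.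
Proof.
case=> p0 NUp _; rewrite ltnNge; apply: contra NUp => /msize1_polyC pE.
rewrite pE rmorph_unit // unitfE; apply: contraNneq p0 => E.
by rewrite pE E mpolyC0.
Qed.

(** Dividing the first generator by a common factor would give a nonzero syzygy
all of whose components have degree less than d j0. *)
Lemma first_generator_primitive (p : S) : prime_elt p -> ~ forall k, divides p (r j0 0 k).
Proof.
move=> pp /fin_all_exists [q qE]; have [p0 _ _] := pp.
pose w : 'rV[S]_3 := \row_k q k.
have rE : r j0 = p *: w by apply/rowP => k; rewrite !mxE qE mulrC.
have Dw : syzygy w.
  have := r_syzygy j0; rewrite /syzygy rE -scalemxAl => E.
  by apply/matrixP => a b; apply: (mulfI p0); move/matrixP/(_ a b): E; rewrite !mxE mulr0.
suff w0 : w = 0 by have := r_neq0 j0; rewrite rE w0 scaler0 eqxx.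
apply: (@vpart_ind _ _ _ (fun=> 0) (fun v => v = 0)) => [//|u v -> ->|t].
  by rewrite addr0.
have [lt|le] := ltP t (d j0).
  exact: syzygy_low_degree (vpart_syzygy _ Dw) (vhomog_vpart _ _ _) lt.
apply/rowP => k; rewrite !mxE addr0; have [->|qk0] := eqVneq (q k) 0; first exact: ipart0.
apply: ipart_msize; have Hk := r_homog j0 k.
have : (msize (r j0 0%R k) <= `|d j0|.+1)%N.
  rewrite msizeE; apply/bigmax_leqP_seq => m mr _; rewrite ltnS.
  have := d_ge0 j0; move: Hk; rewrite addr0; case: (d j0) => //= D Hk _.
  by rewrite (dhomog_mf Hk mr).
rewrite qE msizeM //; have := prime_msize pp; have := d_ge0 j0.
by move: le; move: (d j0) (msize (q k)) (msize p) => D a b le; lia.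
Qed.

Lemma pairing_exists : exists H : 'I_4 -> 'I_4 -> S,
  forall i j k, cross (r i) (r j) k = H i j * F k 0.
Proof.
have /fin_all_exists [H HE] : forall i, exists Hi : 'I_4 -> S,
    forall j k, cross (r i) (r j) k = Hi j * F k 0.
  move=> i; have /fin_all_exists [Hi HiE] : forall j, exists h : S,
      forall k, cross (r i) (r j) k = h * F k 0.
    by move=> j; apply: cross_syzygies; apply: r_syzygy.
  by exists Hi.
by exists H.
Qed.

Variable H : 'I_4 -> 'I_4 -> S.
Hypothesis HE : forall i j k, cross (r i) (r j) k = H i j * F k 0.

Lemma pairingC i j : H j i = - H i j.
Proof. by apply: mul_F_inj => k; rewrite mulNr -!HE crossC. Qed.

Lemma pairingxx i : H i i = 0.
Proof. by apply: mul_F_inj => k; rewrite mul0r -HE crossxx. Qed.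

(** Parallel first generators would make the second a multiple of the first, since
the first has no common factor. *)
Lemma pairing01_neq0 : H j0 j1 != 0.
Proof.
apply/eqP => H0.
have [k rk] : exists k, r j0 0 k != 0.
  apply: boolp.contrapT => /boolp.forallNP E; have /eqP[] := r_neq0 j0.
  by apply/rowP => k; rewrite !mxE; apply/eqP; have /negP := E k; rewrite negbK.
have par : forall i, r j0 0 k * r j1 0 i = r j1 0 k * r j0 0 i.
  have c0 l : cross (r j0) (r j1) l = 0 by rewrite HE H0 mul0r.
  move: (c0 i0) (c0 i1) (c0 i2); rewrite /cross /= => /eqP + /eqP + /eqP.
  rewrite !subr_eq0 => /eqP e0 /eqP e1 /eqP e2 i.
  elim/ord3_ind: k {rk}; elim/ord3_ind: i; try by rewrite mulrC.
  - by rewrite e2 mulrC.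
  - by rewrite -e1 mulrC.
  - by rewrite -e2 mulrC.
  - by rewrite e0 mulrC.
  - by rewrite e1 mulrC.
  - by rewrite -e0 mulrC.
have [q [_ qE]] := cancel_coprime (@factorial_mpoly K 3) rk first_generator_primitive par.
apply: (r_minimal (i := j1) (c := q *: delta_mx 0 j0)); last by rewrite !mxE mulr0.
by rewrite -scalemxAl -rowE rowK; apply/rowP => i; rewrite !mxE qE.
Qed.

(** * The module of relations between the generators *)
Definition relation (b : 'rV[S]_4) := b *m G = 0.

Lemma relation_pairing b j : relation b -> \sum_i b 0 i * H i j = 0.
Proof.
move=> Rb; apply: mul_F_inj => k; rewrite mul0r mulr_suml.
transitivity (cross (b *m G) (r j) k).
  by rewrite cross_mul; apply: eq_bigr => i _; rewrite rowK HE mulrA.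
by rewrite Rb; elim/ord3_ind: k; rewrite /cross /= !mxE; ring.
Qed.

(** The first two generators are independent, so a relation is determined by its
last two coefficients. *)
Lemma relation_inj b : relation b -> b 0 j2 = 0 -> b 0 j3 = 0 -> b = 0.
Proof.
move=> Rb b2 b3; have := relation_pairing j0 Rb; have := relation_pairing j1 Rb.
rewrite !sum4 b2 b3 !pairingxx !mul0r !mulr0 !addr0 add0r.
rewrite [H j1 j0]pairingC mulrN => /eqP + /eqP; rewrite oppr_eq0.
rewrite !mulf_eq0 (negPf pairing01_neq0) !orbF => /eqP b0 /eqP b1.
by apply/rowP; elim/ord4_ind; rewrite ?b0 ?b1 ?b2 ?b3 mxE.
Qed.

(** The linear relation between three vectors of a plane: the coefficient of each
is the pairing of the other two. *)
Definition plane_relation i j k : 'rV[S]_4 :=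
  \row_m (H i j *+ (val m == val k) + H j k *+ (val m == val i)
    + H k i *+ (val m == val j)).

Lemma plane_relationP i j k : relation (plane_relation i j k).
Proof.
have -> : plane_relation i j k =
    H i j *: delta_mx 0 k + H j k *: delta_mx 0 i + H k i *: delta_mx 0 j.
  by apply/rowP => m; rewrite !mxE !mulr_natr.
rewrite /relation !mulmxDl -!scalemxAl -!rowE !rowK.
have [l Fl] := F_neq0; apply/rowP => m; rewrite !mxE; apply: (mulfI Fl).
transitivity (cross (r i) (r j) l * r k 0 m + cross (r j) (r k) l * r i 0 m +
   cross (r k) (r i) l * r j 0 m); first by rewrite !HE; ring.
rewrite mulr0; have [->|ml] := eqVneq m l.
  transitivity (cross (r i) (r j) i0 * r k 0 i0 + cross (r i) (r j) i1 * r k 0 i1 +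
     cross (r i) (r j) i2 * r k 0 i2).
    by elim/ord3_ind: l {Fl}; rewrite /cross /=; ring.
  rewrite !HE; have /syzygyE := r_syzygy k; set E := (X in X = 0) => E0.
  by transitivity (H i j * E); [rewrite /E; ring | rewrite E0 mulr0].
by elim/ord3_ind: l ml {Fl}; elim/ord3_ind: m => //= _; rewrite /cross /=; ring.
Qed.

Let dl i := - d i.

(** Suppose that 'X_0 v + 'X_1 w is a relation.  Then the combination of the
generators with coefficients v is 'X_1 s and that with coefficients w is - 'X_0 s
for some vector s, which is itself a syzygy; writing s in terms of the generators
corrects v and w to relations. *)
Lemma relation_deep : deep_submodule dl relation.
Proof.
split.
- by rewrite /relation mul0mx.
- by move=> v w Mv Mw; rewrite /relation mulmxDl Mv Mw addr0.
- by move=> a v Mv; rewrite /relation -scalemxAl Mv scaler0.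
- move=> t v Mv; rewrite /relation -(vpart_mul _ _ G_homog) Mv; exact: vpart0.
- move=> i v; rewrite /relation -scalemxAl => /rowP E.
  apply/rowP => j; apply: (mulfI (X_neq0 K i)).
  by have := E j; rewrite !mxE mulr0.
move=> v w; rewrite /relation mulmxDl -!scalemxAl => /eqP.
rewrite addr_eq0 => /eqP E.
have /fin_all_exists [s sE] : forall j, exists c,
    (v *m G) 0 j = 'X_i1 * c /\ - (w *m G) 0 j = 'X_i0 * c.
  move=> j; apply: (@X_regular _ _ i0 i1 1) => //; rewrite !expr1 mulrN.
  by have /rowP/(_ j) := E; rewrite !mxE.
pose sv : 'rV[S]_3 := \row_j s j.
have vE : v *m G = 'X_i1 *: sv.
  by apply/rowP => j; rewrite [RHS]mxE [sv _ _]mxE; have [-> _] := sE j.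
have wE : w *m G = - ('X_i0 *: sv).
  by apply/rowP => j; rewrite !mxE; have [_ <-] := sE j; rewrite !mxE opprK.
have /r_gen [b bE] : syzygy sv.
  have GF : G *m F = 0.
    by apply/row_matrixP => i; rewrite row_mul rowK row0; apply: r_syzygy.
  have := congr1 (mulmx^~ F) vE; rewrite /= -mulmxA GF mulmx0 -scalemxAl => E0.
  apply/matrixP => a c'; apply: (mulfI (X_neq0 K i1)).
  by have /matrixP/(_ a c') := E0; rewrite !mxE mulr0.
exists (v - 'X_i1 *: b), (w + 'X_i0 *: b); split.
- by rewrite mulmxBl -scalemxAl -bE vE subrr.
- by rewrite mulmxDl -scalemxAl -bE wE addNr.
- by apply/rowP => j; rewrite !mxE; ring.
Qed.

Lemma dl_le0 i : dl i <= 0.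
Proof. by rewrite oppr_le0. Qed.

Lemma plane_relation_coord : [/\ plane_relation j0 j1 j2 0 j2 = H j0 j1,
  plane_relation j0 j1 j2 0 j3 = 0, plane_relation j0 j1 j3 0 j2 = 0 &
  plane_relation j0 j1 j3 0 j3 = H j0 j1].
Proof. by split; rewrite mxE /= ?mulr0n ?mulr1n ?addr0 ?add0r. Qed.

(** Three relations have rank at most two: the 2 x 2 minors of their last two
coefficients are the coefficients of a linear dependency. *)
Lemma no_greedy_triple rho e : ~ greedy_family dl relation 3 rho e.
Proof.
move=> G3; have ind := greedy_independent dl_le0 relation_deep G3.
have R l : (l < 3)%N -> relation (rho l) by case/G3.
pose x l := rho l 0 j2; pose y l := rho l 0 j3.
pose c l := match l with
  | 0%N => x 1%N * y 2%N - x 2%N * y 1%N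
  | 1%N => x 2%N * y 0%N - x 0%N * y 2%N
  | _ => x 0%N * y 1%N - x 1%N * y 0%N end.
have lin (a : nat -> S) : relation (\sum_(l < 3) a l *: rho l).
  rewrite /relation mulmx_suml big1 // => l _.
  by rewrite -scalemxAl R // scaler0.
have sumE (a : nat -> S) j : (\sum_(l < 3) a l *: rho l) 0 j =
    a 0%N * rho 0%N 0 j + a 1%N * rho 1%N 0 j + a 2%N * rho 2%N 0 j.
  by rewrite summxE sum3 !mxE.
have sumx (a : nat -> S) : (\sum_(l < 3) a l *: rho l) 0 j2 =
    a 0%N * x 0%N + a 1%N * x 1%N + a 2%N * x 2%N by exact: sumE.
have sumy (a : nat -> S) : (\sum_(l < 3) a l *: rho l) 0 j3 =
    a 0%N * y 0%N + a 1%N * y 1%N + a 2%N * y 2%N by exact: sumE.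
have c0 : forall l, (l < 3)%N -> c l = 0.
  apply: ind; apply: relation_inj => //; rewrite (sumx, sumy) /c /=;
    move: (x 0%N) (x 1%N) (x 2%N) (y 0%N) (y 1%N) (y 2%N) => *; ring.
pose a z (l : nat) : S := match l with 0%N => z 1%N | 1%N => - z 0%N | _ => 0 end.
have c2 : x 0%N * y 1%N - x 1%N * y 0%N = 0 by exact: (c0 2%N isT).
have ax : \sum_(l < 3) a x l *: rho l = 0.
  apply: relation_inj => //; rewrite (sumx, sumy) /a /=; first by ring.
  by transitivity (- (x 0%N * y 1%N - x 1%N * y 0%N)); [ring | rewrite c2 oppr0].
have ay : \sum_(l < 3) a y l *: rho l = 0.
  apply: relation_inj => //; rewrite (sumx, sumy) /a /=; last by ring.
  by transitivity (x 0%N * y 1%N - x 1%N * y 0%N); [ring | rewrite c2].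
have x0 : x 0%N = 0 by apply: oppr_inj; rewrite oppr0; exact: (ind _ ax 1%N isT).
have y0 : y 0%N = 0 by apply: oppr_inj; rewrite oppr0; exact: (ind _ ay 1%N isT).
have := greedy_neq0 G3 (l := 0) isT; rewrite (relation_inj _ x0 y0) ?eqxx //.
exact: R.
Qed.

(** One relation does not suffice, as the two plane relations that involve the
first two generators are independent. *)
Lemma relation_basis_exists : exists rho e,
  greedy_family dl relation 2 rho e /\ forall v, relation v -> span 2 rho v.
Proof.
have [m [rho [e [m3 gd sp]]]] := greedy_basis dl_le0 relation_deep no_greedy_triple.
have [c02 c03 c12 c13] := plane_relation_coord.
have [a aE] := sp _ (plane_relationP j0 j1 j2).
have [b bE] := sp _ (plane_relationP j0 j1 j3).
have h0 := pairing01_neq0.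
case: m m3 gd sp aE bE => [|[|[|m]]] // _ gd sp aE bE; last by exists rho, e.
  by case/eqP: h0; rewrite -c02 aE big_ord0 mxE.
move: aE bE; rewrite !big_ord1 => aE bE.
have := c02; rewrite aE mxE => E02; have := c12; rewrite bE mxE => /eqP.
have := c13; rewrite bE mxE => E13.
rewrite mulf_eq0 => /orP [] /eqP E; case/eqP: h0.
  by rewrite -E13 E mul0r.
by rewrite -E02 E mulr0.
Qed.

Variables (rho : nat -> 'rV[S]_4) (e : nat -> int).
Hypothesis rho_greedy : greedy_family dl relation 2 rho e.
Hypothesis rho_span : forall v, relation v -> span 2 rho v.

Lemma rho_relation l : (l < 2)%N -> relation (rho l).
Proof. by case/rho_greedy. Qed.

Lemma rho_independent (c : nat -> S) : c 0%N *: rho 0%N + c 1%N *: rho 1%N = 0 ->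
  c 0%N = 0 /\ c 1%N = 0.
Proof.
move=> E; have ind := greedy_independent dl_le0 relation_deep rho_greedy (c := c).
by split; apply: ind => //; rewrite !big_ord_recr big_ord0 /= add0r.
Qed.

Lemma rho_span2 v : relation v -> exists a b, v = a *: rho 0%N + b *: rho 1%N.
Proof.
by case/rho_span => c ->; exists (c 0%N), (c 1%N); rewrite !big_ord_recr big_ord0 /= add0r.
Qed.

(** An entry of degree zero is a constant, and a nonzero one would express a
generator through the others. *)
Lemma relation_entry_eq0 l i : (l < 2)%N -> e l <= d i -> rho l 0 i = 0.
Proof.
move=> l2 ed; have [Rl Hl _ _] := rho_greedy l2; have := Hl i; rewrite /dl.
have [lt|le] := ltP (e l) (d i).
  by case D : (e l - d i) => [k|k] /=; [lia | move/eqP].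
have -> : e l - d i = 0 by lia.
move=> Hc; apply/eqP; apply: contraT => nz; exfalso.
have [c c0 cE] : exists2 c, c != 0 & rho l 0 i = c%:MP.
  have cE : rho l 0 i = ((rho l 0 i)@_0)%:MP.
    apply/mpolyP => m; rewrite mcoeffC; case: (eqVneq m 0%MM) => [->|m0]; first by rewrite mulr1.
    by rewrite mulr0 (dhomog_nemf_coeff Hc) // mdeg_eq0.
  by exists (rho l 0 i)@_0 => //; apply: contraNneq nz => E; rewrite cE E mpolyC0.
apply: (r_minimal (i := i) (c := delta_mx 0 i - (c^-1)%:MP *: rho l)).
  by rewrite mulmxBl -rowE rowK -scalemxAl Rl scaler0 subr0.
by rewrite !mxE !eqxx cE -mpolyCM mulVf // subrr.
Qed.

(** If e 0 <= d j2, the first relation involves only the first two generators,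
which are independent.  If e 1 <= d j3, no relation involves the last generator. *)
Lemma relation_degree_ge : d j2 + 1 <= e 0%N /\ d j3 + 1 <= e 1%N.
Proof.
have [d01 d12 d23] := d_sorted.
have e01 : e 0%N <= e 1%N by apply: (greedy_degree_mono rho_greedy).
split; rewrite leNgt; apply/negP => lt.
  have := greedy_neq0 rho_greedy (l := 0) isT.
  rewrite (relation_inj (rho_relation (l := 0) isT)) ?eqxx //;
    apply: relation_entry_eq0 => //; lia.
have /rho_span2 [a [b E]] := plane_relationP j0 j1 j3.
have [_ _ _ E3] := plane_relation_coord; case/eqP: pairing01_neq0.
rewrite -E3 E !mxE !(@relation_entry_eq0 _ j3) ?mulr0 ?addr0 //; lia.
Qed.

Let rho0 i := rho 0%N 0 i.
Let rho1 i := rho 1%N 0 i.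
Definition minor i j := rho0 i * rho1 j - rho0 j * rho1 i.

(** Pairing a relation with the first two generators expresses its first two
entries through the last two. *)
Lemma minor_pairing : [/\ H j0 j1 * minor j0 j3 = minor j2 j3 * H j1 j2,
  H j0 j1 * minor j0 j2 = - minor j2 j3 * H j1 j3,
  H j0 j1 * minor j1 j3 = - minor j2 j3 * H j0 j2,
  H j0 j1 * minor j1 j2 = minor j2 j3 * H j0 j3 &
  H j0 j1 * minor j0 j1 = minor j2 j3 * H j2 j3].
Proof.
have X0 : H j0 j1 * rho0 j0 = rho0 j2 * H j1 j2 + rho0 j3 * H j1 j3.
  have := relation_pairing j1 (rho_relation (l := 0) isT); rewrite sum4 pairingxx.
  rewrite [H j2 j1]pairingC [H j3 j1]pairingC -/(rho0 _) => E.
  by apply/eqP; rewrite -subr_eq0 -E; apply/eqP; rewrite /rho0; ring.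
have X1 : H j0 j1 * rho0 j1 = - (rho0 j2 * H j0 j2 + rho0 j3 * H j0 j3).
  have := relation_pairing j0 (rho_relation (l := 0) isT); rewrite sum4 pairingxx.
  rewrite [H j2 j0]pairingC [H j3 j0]pairingC [H j1 j0]pairingC => E.
  by apply/eqP; rewrite -subr_eq0 -oppr_eq0 -E; apply/eqP; rewrite /rho0; ring.
have Y0 : H j0 j1 * rho1 j0 = rho1 j2 * H j1 j2 + rho1 j3 * H j1 j3.
  have := relation_pairing j1 (rho_relation (l := 1) isT); rewrite sum4 pairingxx.
  rewrite [H j2 j1]pairingC [H j3 j1]pairingC => E.
  by apply/eqP; rewrite -subr_eq0 -E; apply/eqP; rewrite /rho1; ring.
have Y1 : H j0 j1 * rho1 j1 = - (rho1 j2 * H j0 j2 + rho1 j3 * H j0 j3).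
  have := relation_pairing j0 (rho_relation (l := 1) isT); rewrite sum4 pairingxx.
  rewrite [H j2 j0]pairingC [H j3 j0]pairingC [H j1 j0]pairingC => E.
  by apply/eqP; rewrite -subr_eq0 -oppr_eq0 -E; apply/eqP; rewrite /rho1; ring.
(* The Pluecker relation. *)
have P : H j0 j1 * H j2 j3 = H j0 j2 * H j1 j3 - H j0 j3 * H j1 j2.
  have := relation_pairing j3 (plane_relationP j0 j1 j2); rewrite sum4 !mxE /= ?mulr0n ?mulr1n ?addr0 ?add0r.
  rewrite [H j2 j0]pairingC => E.
  by apply/eqP; rewrite -subr_eq0 -E; apply/eqP; ring.
split.
- transitivity (H j0 j1 * rho0 j0 * rho1 j3 - rho0 j3 * (H j0 j1 * rho1 j0)); first by rewrite /minor; ring.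
  by rewrite X0 Y0 /minor; ring.
- transitivity (H j0 j1 * rho0 j0 * rho1 j2 - rho0 j2 * (H j0 j1 * rho1 j0)); first by rewrite /minor; ring.
  by rewrite X0 Y0 /minor; ring.
- transitivity (H j0 j1 * rho0 j1 * rho1 j3 - rho0 j3 * (H j0 j1 * rho1 j1)); first by rewrite /minor; ring.
  by rewrite X1 Y1 /minor; ring.
- transitivity (H j0 j1 * rho0 j1 * rho1 j2 - rho0 j2 * (H j0 j1 * rho1 j1)); first by rewrite /minor; ring.
  by rewrite X1 Y1 /minor; ring.
- apply: (mulfI pairing01_neq0).
  transitivity (H j0 j1 * rho0 j0 * (H j0 j1 * rho1 j1) - H j0 j1 * rho0 j1 * (H j0 j1 * rho1 j0)).
    by rewrite /minor; ring.
  rewrite X0 Y0 X1 Y1 mulrCA P /minor; ring.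
Qed.

(** If p divides all minors, the basis is dependent modulo p; the quotient by p of
such a dependency is again a relation, which contradicts that the basis spans. *)
Lemma minor_primitive (p : S) : prime_elt p -> ~ forall i j, divides p (minor i j).
Proof.
move=> [p0 NUp pP] pm.
have divp (v : 'rV[S]_4) : relation v -> (forall i, divides p (v 0 i)) ->
    exists a b, v = p *: (a *: rho 0%N + b *: rho 1%N).
  move=> Rv /fin_all_exists [q qE]; pose w : 'rV[S]_4 := \row_i q i.
  have vE : v = p *: w by apply/rowP => i; rewrite !mxE qE mulrC.
  have [|a [b wE]] := @rho_span2 w; last by exists a, b; rewrite -wE.
  move: Rv; rewrite /relation vE -scalemxAl => /matrixP E.
  by apply/matrixP => i j; apply: (mulfI p0); have := E i j; rewrite !mxE mulr0.
have [px|] := boolp.EM (forall i, divides p (rho0 i)).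
  have [a [b E]] := divp _ (rho_relation (l := 0) isT) px.
  have [] := rho_independent (c := fun l => if l == 0%N then p * a - 1 else p * b).
    move: E; rewrite scalerDr !scalerA scalerBl scale1r /= => E.
    by rewrite addrAC -E subrr.
  move=> /eqP; rewrite subr_eq0 => /eqP pa _; case/negP: NUp.
  by apply/unitrP; exists a; rewrite mulrC pa.
move=> /boolp.existsNP [i Ni].
have [||a [b E]] := divp (rho0 i *: rho 1%N - rho1 i *: rho 0%N).
- by rewrite /relation mulmxBl -!scalemxAl !rho_relation // !scaler0 subrr.
- by move=> j; rewrite !mxE [rho1 i * _]mulrC; apply: pm.
have [] := rho_independent (c := fun l => if l == 0%N then - rho1 i - p * a else rho0 i - p * b).
  transitivity (rho0 i *: rho 1%N - rho1 i *: rho 0%N - p *: (a *: rho 0%N + b *: rho 1%N)).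
    by apply/rowP => j; rewrite /= !mxE; ring.
  by rewrite E subrr.
by move=> _ /eqP; rewrite subr_eq0 => /eqP xE; apply: Ni; rewrite xE; exists b; rewrite mulrC.
Qed.

(** The pairings of the Koszul syzygies are, up to sign, the entries of F, and they
are combinations of the pairings of the generators. *)
Lemma pairing_primitive (p : S) : prime_elt p -> ~ forall i j, divides p (H i j).
Proof.
move=> pp pH; apply: (F_primitive pp).
have main a b : divides p (koszul b 0 a).
  have /r_gen [u uE] := koszul_syzygy a; have /r_gen [v vE] := koszul_syzygy b.
  suff -> : koszul b 0 a = \sum_i \sum_j u 0 i * (v 0 j * H i j).
    by apply: divides_sum => i _; apply: divides_sum => j _; do 2!apply: divides_mulr.
  apply: mul_F_inj => k; rewrite -cross_koszul; last exact: koszul_syzygy.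
  rewrite uE cross_mul mulr_suml; apply: eq_bigr => i _.
  rewrite rowK vE cross_mul_r mulr_suml mulr_sumr; apply: eq_bigr => j _.
  by rewrite rowK HE; ring.
elim/ord3_ind.
- by have := main i1 i2; rewrite mxE.
- by have := main i2 i0; rewrite mxE.
- by have := main i0 i1; rewrite mxE.
Qed.

Lemma pairing_homog i j : ihomog (d i + d j - N) (H i j).
Proof.
have [k Fk] := F_neq0; apply: (ihomog_cancel (F_homog k) Fk).
rewrite mulrC -HE subrK; have := r_homog i; have := r_homog j.
move: (r i) (r j) => u v Hv Hu.
have HH a b : ihomog (d i + d j) (u 0 a * v 0 b).
  by have := ihomogM (Hu a) (Hv b); rewrite !addr0.
by elim/ord3_ind: k {Fk}; rewrite /cross /=; apply: ihomogD => //; apply: ihomogN.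
Qed.

Lemma minor_homog i j : ihomog (e 0%N + e 1%N - d i - d j) (minor i j).
Proof.
have [_ H0 _ _] := rho_greedy (l := 0) isT; have [_ H1 _ _] := rho_greedy (l := 1) isT.
apply: ihomogD; last apply: ihomogN.
  have -> : e 0%N + e 1%N - d i - d j = (e 0%N + dl i) + (e 1%N + dl j) by rewrite /dl; ring.
  exact: ihomogM.
have -> : e 0%N + e 1%N - d i - d j = (e 0%N + dl j) + (e 1%N + dl i) by rewrite /dl; ring.
exact: ihomogM.
Qed.

Lemma unit_mpolyC (q : S) : q \is a GRing.unit -> exists2 c, c != 0 & q = c%:MP.
Proof.
move=> Uq; have q0 : q != 0 by apply: contraTneq Uq => ->; rewrite unitr0.
have qi0 : q^-1 != 0 by rewrite invr_eq0.
have qE : q = (q@_0)%:MP.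
  apply: msize1_polyC; have := msizeM q0 qi0; rewrite mulrV // msize1.
  have : (0 < msize q^-1)%N by rewrite lt0n msize_poly_eq0.
  by move: (msize q) (msize q^-1) => a b; lia.
by exists (q@_0) => //; apply: contraNneq q0 => E; rewrite qE E mpolyC0.
Qed.

Lemma exists_prime : exists p : S, prime_elt p.
Proof.
have [n Hn] := @factorial_mpoly K 3 _ (X_neq0 K i0).
have : msize ('X_i0 : S) = 2 by rewrite msizeX mdeg1.
case: Hn => [u /unit_mpolyC [c _ ->]|m p c pp _ _]; last by exists p.
by rewrite msizeC; case: eqP.
Qed.

(** By [minor_pairing] the minors are proportional to the complementary pairings.
As neither family has a common factor, the ratio is a unit, so corresponding
members have the same degree. *)
Lemma degree_sum : e 0%N + e 1%N = d j0 + d j1 + d j2 + d j3 - N.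
Proof.
(* Pairings and signed complementary minors, listed in the same order. *)
pose h n := nth 0 [:: H j0 j1; H j0 j2; H j0 j3; H j1 j2; H j1 j3; H j2 j3] n.
pose a n := nth 0 [:: minor j2 j3; - minor j1 j3; minor j1 j2; minor j0 j3;
  - minor j0 j2; minor j0 j1] n.
have [m03 m02 m13 m12 m01] := minor_pairing.
have mC i j : minor j i = - minor i j by rewrite /minor opprB.
have mxx i : minor i i = 0 by rewrite /minor subrr.
have [|n|q [qE aE]] := cancel_coprime (@factorial_mpoly K 3) pairing01_neq0
    (h := h) (a := a) (b := minor j2 j3).
- move=> p pp ph; apply: (pairing_primitive pp).
  have := (ph 0%N, ph 1%N, ph 2%N, ph 3%N, ph 4%N, ph 5%N); rewrite /h /=.
  move=> [[[[[D01 D02] D03] D12] D13] D23].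
  elim/ord4_ind; elim/ord4_ind => //; rewrite ?pairingxx; try exact: divides0;
    by rewrite pairingC; apply: dividesN.
- case: n => [|[|[|[|[|[|n]]]]]]; rewrite /h /a /=; rewrite ?mulrN.
  + by rewrite mulrC.
  + by rewrite m13 mulNr opprK.
  + by rewrite m12.
  + by rewrite m03.
  + by rewrite m02 mulNr opprK.
  + by rewrite m01.
  + by rewrite !nth_nil !mulr0.
have noprime p : prime_elt p -> ~ divides p q.
  move=> pp [s sE]; apply: (minor_primitive pp).
  have D n : divides p (a n) by rewrite aE sE; exists (s * h n); ring.
  have := (D 0%N, D 1%N, D 2%N, D 3%N, D 4%N, D 5%N); rewrite /a /=.
  move=> [[[[[D23 /dividesN D13] D12] D03] /dividesN D02] D01].
  rewrite !opprK in D13 D02.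
  elim/ord4_ind; elim/ord4_ind => //; rewrite ?mxx; try exact: divides0;
    by rewrite mC; apply: dividesN.
have q0 : q != 0.
  have [p pp] := exists_prime; apply/eqP => E; apply: (noprime p pp).
  by rewrite E; apply: divides0.
have Uq : q \is a GRing.unit by apply: unit_of_no_prime (@factorial_mpoly K 3) _ q0 noprime.
have [c c0 qc] := unit_mpolyC Uq.
have m0 : minor j2 j3 != 0 by rewrite qE mulf_neq0 // pairing01_neq0.
have := ihomog_uniq m0 (minor_homog j2 j3) (e := d j0 + d j1 - N).
rewrite qE qc mul_mpolyC => /(_ (ihomogZ _ (pairing_homog _ _))); lia.
Qed.

(** * Self-duality of the module of syzygies *)
Definition rho_mx : 'M[S]_(4, 2) := \matrix_(i, l) rho l 0 i.

Lemma rho_mx_homog : mhomog d (fun l : 'I_2 => e l) rho_mx.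
Proof.
move=> i l; rewrite mxE; have [_ Hl _ _] := rho_greedy (ltn_ord l); exact: Hl.
Qed.

(** The vector g lists the pairings of the generators with w. *)
Definition theta (w : 'rV[S]_3) (g : 'rV[S]_4) :=
  syzygy w /\ forall i k, cross (r i) w k = g 0 i * F k 0.

Lemma theta_linear a w g w' g' : theta w g -> theta w' g' ->
  theta (a *: w + w') (a *: g + g').
Proof.
move=> [Dw E] [Dw' E']; split=> [|i k].
  by rewrite /syzygy mulmxDl -scalemxAl Dw Dw' scaler0 addr0.
by rewrite cross_linear_r E E' !mxE; ring.
Qed.

Lemma theta_total w : syzygy w -> exists g, theta w g.
Proof.
move=> Dw; have /fin_all_exists [g gE] : forall i, exists h,
    forall k, cross (r i) w k = h * F k 0.
  by move=> i; apply: cross_syzygies => //; apply: r_syzygy.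
by exists (\row_i g i); split=> // i k; rewrite mxE.
Qed.

Lemma theta_ker w g : theta w g -> g *m rho_mx = 0.
Proof.
move=> [Dw E]; apply/rowP => l; rewrite !mxE; apply: mul_F_inj => k.
transitivity (cross (rho l *m G) w k).
  rewrite cross_mul mulr_suml; apply: eq_bigr => i _.
  by rewrite rowK E mxE; ring.
rewrite rho_relation //.
by elim/ord3_ind: k; rewrite /cross /= !mxE; ring.
Qed.

(** Since g is orthogonal to all relations, it defines a linear form on D0.  If w
is a preimage, the triple product expansion shows that its coordinates are the
values of this form on the Koszul syzygies; conversely these values do define a
preimage. *)
Lemma theta_surjective g : g *m rho_mx = 0 -> exists w, theta w g.
Proof.
(* The linear form, in terms of coefficients with respect to the generators. *)
move=> g0; pose pr (b : 'rV[S]_4) := \sum_i b 0 i * g 0 i.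
have prD a b b' : pr (a *: b + b') = a * pr b + pr b'.
  rewrite /pr mulr_sumr -big_split; apply: eq_bigr => i _; rewrite !mxE /=; ring.
have pr_rel b : relation b -> pr b = 0.
  move=> /rho_span2 [x' [y' ->]]; have pr_rho (l : 'I_2) : pr (rho l) = 0.
    have /rowP/(_ l) := g0; rewrite !mxE => E; rewrite -[RHS]E.
    by apply: eq_bigr => i _; rewrite mxE mulrC.
  have := pr_rho ord0; have := pr_rho ord_max => /= r1 r0.
  rewrite prD r0 mulr0 add0r -[_ *: _]addr0 prD r1 mulr0 add0r /pr big1 // => i _.
  by rewrite mxE mul0r.
have /fin_all_exists [b bE] : forall k, exists c : 'rV_4, koszul k = c *m G.
  by move=> k; apply/r_gen/koszul_syzygy.
pose w : 'rV[S]_3 := \row_k pr (b k).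
have relE (a0 a1 a2 : S) c : a0 *: koszul i0 + (a1 *: koszul i1 + a2 *: koszul i2) = c *m G ->
    a0 * w 0 i0 + a1 * w 0 i1 + a2 * w 0 i2 = pr c.
  move=> E; pose z := a0 *: b i0 + (a1 *: b i1 + (a2 *: b i2 + 0)).
  have zE : z *m G = c *m G.
    by rewrite -E !bE /z addr0 !mulmxDl -!scalemxAl.
  have /pr_rel : relation ((-1) *: c + z).
    by rewrite /relation mulmxDl -scalemxAl zE scaleN1r addNr.
  have pr0 : pr 0 = 0 by rewrite /pr big1 // => i _; rewrite mxE mul0r.
  rewrite prD mulN1r addrC => /eqP; rewrite subr_eq0 => /eqP <-.
  by rewrite /z !prD pr0 addr0 !mxE addrA.
exists w; split=> [|i k].
  apply/syzygyE; rewrite ![_ * F _ _]mulrC (relE _ _ _ 0).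
    by rewrite /pr big1 // => i _; rewrite mxE mul0r.
  by rewrite mul0mx; apply/rowP; elim/ord3_ind; rewrite !mxE /=; ring.
have /syzygyE Di := r_syzygy i; set E := (X in X = 0) in Di.
have prd : pr (F k 0 *: delta_mx 0 i) = g 0 i * F k 0.
  rewrite /pr (bigD1 i) //= big1 => [|j ji]; last by rewrite !mxE (negPf ji) andbF mulr0 mul0r.
  by rewrite !mxE !eqxx mulr1 addr0 mulrC.
have rE : F k 0 *: delta_mx 0 i *m G = F k 0 *: r i by rewrite -scalemxAl -rowE rowK.
rewrite -prd; elim/ord3_ind: k {prd} rE => rE.
- rewrite -(relE 0 (- r i 0 i2) (r i 0 i1)); first by rewrite /cross /=; ring.
  rewrite rE; apply/rowP; elim/ord3_ind; rewrite !mxE /=; try ring.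
  by apply/eqP; rewrite -subr_eq0; apply/eqP; transitivity (- E); [rewrite /E; ring|rewrite Di oppr0].
- rewrite -(relE (r i 0 i2) 0 (- r i 0 i0)); first by rewrite /cross /=; ring.
  rewrite rE; apply/rowP; elim/ord3_ind; rewrite !mxE /=; try ring.
  by apply/eqP; rewrite -subr_eq0; apply/eqP; transitivity (- E); [rewrite /E; ring|rewrite Di oppr0].
- rewrite -(relE (- r i 0 i1) (r i 0 i0) 0); first by rewrite /cross /=; ring.
  rewrite rE; apply/rowP; elim/ord3_ind; rewrite !mxE /=; try ring.
  by apply/eqP; rewrite -subr_eq0; apply/eqP; transitivity (- E); [rewrite /E; ring|rewrite Di oppr0].
Qed.

(** A syzygy with zero pairings pairs to zero with the Koszul syzygies, so its
coordinates vanish by [cross_koszul]. *)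
Lemma theta_inj_l w : theta w 0 -> w = 0.
Proof.
move=> [Dw E]; apply/rowP => k; rewrite [RHS]mxE; apply: mul_F_inj => l.
have /r_gen [u uE] := koszul_syzygy k.
rewrite -cross_koszul // uE cross_mul mul0r big1 // => i _.
by rewrite rowK E !mxE mul0r mulr0.
Qed.

Lemma theta_inj_r g : theta 0 g -> g = 0.
Proof.
move=> [_ E]; apply/rowP => i; rewrite [RHS]mxE; apply: mul_F_inj => k.
by rewrite -E mul0r; elim/ord3_ind: k; rewrite /cross /= !mxE; ring.
Qed.

Lemma theta_vpart t w g : theta w g ->
  theta (vpart (fun=> 0) t w) (vpart d (t - N) g).
Proof.
move=> [Dw E]; split=> [|i k]; first exact: vpart_syzygy.
transitivity (ipart (d i + t) (cross (r i) w k)).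
  have Hr a := r_homog i a; rewrite addr0 in Hr.
  have HH a b : ipart (d i + t) (r i 0 a * w 0 b) = r i 0 a * ipart (t + 0) (w 0 b).
    by rewrite (ipartM _ _ (Hr a)); congr (_ * ipart _ _); ring.
  by elim/ord3_ind: k; rewrite /cross /= ipartD ipartN !HH !mxE.
rewrite E mulrC (ipartM _ _ (F_homog k)) mxE mulrC.
by congr (ipart _ _ * _); ring.
Qed.

(** * Hilbert functions *)
Local Notation e2 := (fun l : 'I_2 => e l).
Local Notation dim := (qdim (@mpolyC 3 K)).

Lemma dim_relation t : dim (ker_part dl G t) (eq^~ 0) (\sum_(l < 2) hdim (t - e l)).
Proof.
have H0 := @qdim_vhomog K 2 (fun l => - e l) t.
pose B : 'M[S]_(2, 4) := \matrix_(l, i) rho l 0 i.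
have mulB (c : 'rV_2) : c *m B = c 0 ord0 *: rho 0%N + c 0 ord_max *: rho 1%N.
  apply/rowP => i; rewrite !mxE big_ord_recr big_ord1 /= !mxE /=.
  by congr (c 0 _ * _ + _); apply: val_inj.
have BH : mhomog (fun l : 'I_2 => - e l) dl B.
  move=> l i; have [_ Hl _ _] := rho_greedy (ltn_ord l); rewrite mxE opprK addrC; exact: Hl.
have Brel (c : 'rV_2) : c *m B *m G = 0.
  by rewrite mulB mulmxDl -!scalemxAl !rho_relation // !scaler0 addr0.
have Binj (c : 'rV_2) : c *m B = 0 -> c = 0.
  rewrite mulB => /(rho_independent (c := fun l => if l == 0%N then c 0 ord0 else c 0 ord_max)) /= [c0 c1].
  apply/rowP => -[[|[|l]] lt] //; rewrite [RHS]mxE.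
    by rewrite -[RHS]c0; congr (c 0 _); apply: val_inj.
  by rewrite -[RHS]c1; congr (c 0 _); apply: val_inj.
move: H0; apply: (qdim_correspondence (E := fun b c => b = c *m B)).
- exact: ker_part_subspace.
- exact: vhomog_subspace.
- by rewrite mul0mx.
- by move=> a u v u' v' -> ->; rewrite mulmxDl -scalemxAl.
- by move=> c Hc; exists (c *m B) => //; split; [apply: vhomog_mul Hc | apply: Brel].
- move=> b [Hb /rho_span2 [x' [y' bE]]].
  pose c : 'rV[S]_2 := \row_l (if l == ord0 then x' else y').
  exists (vpart (fun l => - e l) t c); first exact: vhomog_vpart.
  rewrite -(vpart_mul _ _ BH) -{1}(vpart_id Hb); congr vpart.
  by rewrite mulB !mxE /=.
- by move=> b c _ _ ->; split=> [/Binj|->]; rewrite ?mul0mx.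
Qed.

Definition syzygy_dim t : int := \sum_i (hdim (t - d i))%:Z - \sum_(l < 2) (hdim (t - e l))%:Z.

Lemma dim_syzygy t : exists2 k, dim (ker_part (fun=> 0) F t) (eq^~ 0) k & k%:Z = syzygy_dim t.
Proof.
have H0 := @qdim_vhomog K 4 dl t.
have [le Hi] := rank_nullity G_homog H0 (dim_relation t).
exists (\sum_i hdim (t + dl i) - \sum_(l < 2) hdim (t - e l))%N; last first.
  by rewrite -subzn // !Posz_sum.
have [v [Uv spv frv]] := Hi; exists v; split=> // [i|u [Hu Du]].
  by have [Hv [b bE]] := Uv i; split=> //; apply/r_gen; exists b.
apply: spv; split=> //; exact/r_gen.
Qed.

Lemma theta_iso : kernel_iso F rho_mx theta.
Proof.
split.
- exact: theta_linear.
- by move=> w g [].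
- exact: theta_ker.
- exact: theta_total.
- exact: theta_surjective.
- exact: theta_inj_l.
- exact: theta_inj_r.
Qed.

Lemma dim_dual_kernel t : exists2 k, dim (ker_part d rho_mx (t - N)) (eq^~ 0) k &
  k%:Z = syzygy_dim t.
Proof.
have [k Hk kE] := dim_syzygy t; exists k => //; move: Hk.
apply: (qdim_correspondence (E := fun g w => theta w g)).
- exact: ker_part_subspace.
- exact: ker_part_subspace.
- exact: iso0 theta_iso.
- by move=> a u v u' v' Hu Hv; apply: theta_linear.
- move=> w [Hw /theta_total [g wg]]; have := theta_vpart t wg.
  rewrite (vpart_id Hw) => wg'; exists (vpart d (t - N) g) => //.
  by split; [apply: vhomog_vpart | apply: theta_ker wg'].
- move=> g [Hg /theta_surjective [w wg]]; have := theta_vpart t wg.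
  rewrite (vpart_id Hg) => wg'; exists (vpart (fun=> 0) t w) => //.
  by split; [apply: vhomog_vpart | case: wg'].
- by move=> g w _ _ wg; split=> E; rewrite E in wg; [apply: theta_inj_l | apply: theta_inj_r].
Qed.

(** Rank and nullity, the kernel being computed through self-duality. *)
Lemma dim_cokernel t : exists2 k,
  dim (vhomog e2 (t - N)) (im_part e2 rho_mx (t - N)) k &
  k%:Z = \sum_(l < 2) (hdim (t - N + e l))%:Z - \sum_i (hdim (t - N + d i))%:Z + syzygy_dim t.
Proof.
have [k Hk kE] := dim_dual_kernel t.
have [le1 H1] := rank_nullity rho_mx_homog (@qdim_vhomog K 4 d (t - N)) Hk.
have [|||||le2 H2] := qdim_quotient _ _ _ _ _ (@qdim_vhomog K 2 e2 (t - N)) H1.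
- exact: vhomog_subspace.
- exact: im_part_subspace.
- exact: zero_subspace.
- by move=> u ->; case: (im_part_subspace (n := 3) e2 rho_mx (t - N)).
- by move=> u [].
exists (\sum_(l < 2) hdim (t - N + e l) - (\sum_i hdim (t - N + d i) - k))%N => //.
rewrite -!Posz_sum -kE; move: le1 le2 => /=.
move: (\sum_i _)%N (\sum_(l < 2) _)%N => a b; lia.
Qed.

Definition saturated (x : 'rV[S]_1) := exists n, forall i, exists a, 'X_i ^+ n *: x = a *m F.

Lemma F_mhomog : mhomog (fun=> 0) (fun=> N) F.
Proof. by move=> i j; rewrite ord1 subr0. Qed.

Lemma related_saturated x u : related F rho_mx theta x u -> saturated x.
Proof. by move=> [n [a [v [aE _ _]]]]; exists n => i; exists (a i). Qed.

Lemma saturated_related x : saturated x -> exists u, related F rho_mx theta x u.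
Proof.
move=> [n /fin_all_exists [a aE]].
have [u [m um]] : exists u, related rho_mx F (fun g w => theta w g) u x.
  by have [u Hu] := related_exists (kernel_iso_sym theta_iso) aE; exists u, n.
by exists u; apply/related_sym; exists m.
Qed.

(** If the cokernel vanishes in large degrees, every u has multiples by powers of
the variables in the image, so it is related to some saturated x. *)
Lemma dim_saturated t k :
  (exists T, forall t u, T <= t -> vhomog e2 (t - N) u -> im_part e2 rho_mx (t - N) u) ->
  dim (vhomog e2 (t - N)) (im_part e2 rho_mx (t - N)) k ->
  dim (fun x => vhomog (fun=> N) t x /\ saturated x) (im_part (fun=> N) F t) k.
Proof.
move=> [T HT]; apply: (qdim_correspondence (E := related F rho_mx theta)).
- have [h0 hl] : subspace (@mpolyC 3 K) (vhomog (fun=> N) t : 'rV_1 -> Prop) by apply: vhomog_subspace.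
  split=> [|a x y [Hx Sx] [Hy Sy]]; first by split=> //; exists 0%N => i; exists 0; rewrite mul0mx scaler0.
  split; first exact: hl.
  have [u Hu] := saturated_related Sx; have [w Hw] := saturated_related Sy.
  exact: (related_saturated (related_linear theta_iso a%:MP Hu Hw)).
- exact: vhomog_subspace.
- exact: related0 theta_iso.
- by move=> a x y u w Hx Hy; apply: (related_linear theta_iso).
- move=> u Hu; pose n := `|T - t|%N.
  have /fin_all_exists [v vE] : forall i : 'I_3, exists v, 'X_i ^+ n *: u = v *m rho_mx.
    move=> i; have le : T <= t + n%:Z by rewrite /n; lia.
    have Hn : vhomog e2 (t + n%:Z - N) ('X_i ^+ n *: u).
      have -> : t + n%:Z - N = n%:Z + (t - N) by ring.
      by apply: vhomogZ Hu; apply: ihomogXn.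
    by have [_] := HT _ _ le Hn.
  have [x Hx] := related_exists theta_iso vE.
  have Rx : related F rho_mx theta x u by exists n.
  have := related_vpart F_mhomog rho_mx_homog theta_vpart t Rx; rewrite (vpart_id Hu) => Rx'.
  exists (vpart (fun=> N) t x) => //.
  by split; [apply: vhomog_vpart | apply: related_saturated Rx'].
- move=> x [Hx /saturated_related [u Rx]].
  have := related_vpart F_mhomog rho_mx_homog theta_vpart t Rx; rewrite (vpart_id Hx) => Rx'.
  by exists (vpart e2 (t - N) u) => //; apply: vhomog_vpart.
- move=> x u [Hx _] Hu Rx; split=> -[_ im]; split=> //.
    exact: (related_image theta_iso Rx im).
  exact: (related_image (kernel_iso_sym theta_iso) ((related_sym _ _ _ _ _).1 Rx) im).
Qed.
End Syzygies.

(** * The maximum of the Hilbert function *)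
Definition pos_part (z : int) : int := if 0 <= z then z else 0.

Lemma hdim_step (z : int) : (hdim z)%:Z = (hdim (z - 1))%:Z + pos_part (z + 1).
Proof.
have pos_ge (y : int) : 0 <= y -> pos_part y = y by rewrite /pos_part => ->.
case: z => [[|k]|k].
- by rewrite pos_ge //= bin0.
- rewrite pos_ge; last by lia.
  rewrite (_ : k.+1%:Z - 1 = k%:Z) /=; last by lia.
  by rewrite addSn binS addn2 binSn; lia.
- have -> : pos_part (Negz k + 1) = 0 by rewrite /pos_part; case: leP => //; lia.
  by rewrite (_ : Negz k - 1 = Negz k.+1) //; lia.
Qed.

(** The dimension found in [dim_cokernel] when N = d0 + d1 - 2 and the relations
have degrees d2 + 1 and d3 + 1. *)
Definition cokernel_count (d0 d1 d2 d3 t : int) : int :=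
  let s := t - (d0 + d1 - 2) in
  ((hdim (s + (d2 + 1)))%:Z + (hdim (s + (d3 + 1)))%:Z)
  - ((hdim (s + d0))%:Z + (hdim (s + d1))%:Z + (hdim (s + d2))%:Z + (hdim (s + d3))%:Z)
  + ((hdim (t - d0))%:Z + (hdim (t - d1))%:Z + (hdim (t - d2))%:Z + (hdim (t - d3))%:Z
  - ((hdim (t - (d2 + 1)))%:Z + (hdim (t - (d3 + 1)))%:Z)).

(** Each relation degree exceeds a generator degree by one, and N + 2 = d0 + d1,
so the binomial coefficients combine to sums of first differences. *)
Lemma cokernel_countE d0 d1 d2 d3 t :
  cokernel_count d0 d1 d2 d3 t =
  pos_part (t + d2 - d0 - d1 + 4) + pos_part (t + d3 - d0 - d1 + 4)
  + pos_part (t - d2 + 1) + pos_part (t - d3 + 1)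
  - (pos_part (t - d0 + 3) + pos_part (t - d0 + 2))
  - (pos_part (t - d1 + 3) + pos_part (t - d1 + 2)).
Proof.
rewrite /cokernel_count /=; set N := d0 + d1 - 2.
have e2 : (hdim (t - N + (d2 + 1)))%:Z = (hdim (t - N + d2))%:Z + pos_part (t + d2 - d0 - d1 + 4).
  by rewrite hdim_step; congr ((hdim _)%:Z + pos_part _); rewrite /N; ring.
have e3 : (hdim (t - N + (d3 + 1)))%:Z = (hdim (t - N + d3))%:Z + pos_part (t + d3 - d0 - d1 + 4).
  by rewrite hdim_step; congr ((hdim _)%:Z + pos_part _); rewrite /N; ring.
have f2 : (hdim (t - d2))%:Z = (hdim (t - (d2 + 1)))%:Z + pos_part (t - d2 + 1).
  by rewrite hdim_step; congr ((hdim _)%:Z + pos_part _); ring.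
have f3 : (hdim (t - d3))%:Z = (hdim (t - (d3 + 1)))%:Z + pos_part (t - d3 + 1).
  by rewrite hdim_step; congr ((hdim _)%:Z + pos_part _); ring.
have g0 : (hdim (t - N + d0))%:Z = (hdim (t - d1))%:Z
    + (pos_part (t - d1 + 3) + pos_part (t - d1 + 2)).
  rewrite hdim_step hdim_step -addrA [X in _ + X]addrC.
  by congr ((hdim _)%:Z + (pos_part _ + pos_part _)); rewrite /N; ring.
have g1 : (hdim (t - N + d1))%:Z = (hdim (t - d0))%:Z
    + (pos_part (t - d0 + 3) + pos_part (t - d0 + 2)).
  rewrite hdim_step hdim_step -addrA [X in _ + X]addrC.
  by congr ((hdim _)%:Z + (pos_part _ + pos_part _)); rewrite /N; ring.
by rewrite e2 e3 f2 f3 g0 g1; ring.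
Qed.

Section Bounds.
Variables d0 d1 d2 d3 : int.
Hypotheses (d0_ge0 : 0 <= d0) (d01 : d0 <= d1) (d12 : d1 <= d2) (d23 : d2 <= d3).

Lemma cokernel_count_large t : d0 + d1 + d2 + d3 <= t ->
  cokernel_count d0 d1 d2 d3 t = 0.
Proof.
by move=> le; rewrite cokernel_countE /pos_part; do 8!(case: ifP => ?; try by exfalso; lia); lia.
Qed.

Definition defect := d2 + d3 - 2 * d1 + (if d0 == d1 then 2 else 3).

Lemma cokernel_count_max t : cokernel_count d0 d1 d2 d3 t <= defect.
Proof.
by rewrite cokernel_countE /pos_part /defect; case: eqP => ?;
  do 8!(case: ifP => ?; try by exfalso; lia); lia.
Qed.

Lemma cokernel_count_middle : cokernel_count d0 d1 d2 d3 (d0 - 2) = defect.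
Proof.
by rewrite cokernel_countE /pos_part /defect; case: eqP => ?;
  do 8!(case: ifP => ?; try by exfalso; lia); lia.
Qed.

End Bounds.

(** * The Jacobian module of a curve of type 2B *)
Section TypeTwo.
Variable K : fieldType.
Local Notation S := {mpoly K[3]}.
Local Notation dim := (qdim (@mpolyC 3 K)).
Variables (F : 'cV[S]_3) (N : int).
Hypothesis F_homog : forall k, ihomog N (F k 0).
Hypothesis F_primitive : forall p : S, prime_elt p -> ~ forall k, divides p (F k 0).
Variables (r : 'I_4 -> 'rV[S]_3) (d : 'I_4 -> int).
Hypothesis r_gen : forall w, syzygy F w <-> exists c : 'rV_4, w = c *m \matrix_i r i.
Hypothesis r_homog : forall i, vhomog (fun=> 0) (d i) (r i).
Hypothesis r_minimal : forall i (c : 'rV_4), r i = c *m \matrix_i r i -> c 0 i = 0 -> False.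
Hypothesis d_ge0 : forall i, 0 <= d i.
Hypothesis d_sorted : [/\ d j0 <= d j1, d j1 <= d j2 & d j2 <= d j3].
Hypothesis type2 : N = d j0 + d j1 - 2.

(** The lower bounds of [relation_degree_ge] add up to the sum of [degree_sum], so
both are equalities. *)
Lemma dim_jacobian_module t : exists2 k,
  dim (fun x => vhomog (fun=> N) t x /\ saturated F x) (im_part (fun=> N) F t) k &
  k%:Z = cokernel_count (d j0) (d j1) (d j2) (d j3) t.
Proof.
have F_neq0 : exists k, F k 0 != 0.
  have [p pp] := exists_prime K; apply: boolp.contrapT => /boolp.forallNP F0.
  apply: (F_primitive pp) => k; have /negP := F0 k; rewrite negbK => /eqP ->.
  exact: divides0.
have [H HE] := pairing_exists F_neq0 F_primitive r_gen.
have [rho [e [G sp]]] := relation_basis_exists F_homog F_neq0 r_gen r_homog r_minimal d_ge0 d_sorted HE.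
have esum := degree_sum F_homog F_neq0 F_primitive r_gen r_homog r_minimal d_ge0 d_sorted HE G sp.
have [e0 e1] : e 0%N = d j2 + 1 /\ e 1%N = d j3 + 1.
  have [] := relation_degree_ge F_homog F_neq0 r_gen r_homog r_minimal d_ge0 d_sorted HE G sp.
  by move: esum; rewrite type2; lia.
have coker s : exists2 k, dim (vhomog (fun l : 'I_2 => e l) (s - N))
    (im_part (fun l : 'I_2 => e l) (rho_mx rho) (s - N)) k &
    k%:Z = cokernel_count (d j0) (d j1) (d j2) (d j3) s.
  have [k Hk kE] := dim_cokernel F_homog F_neq0 F_primitive r_gen r_homog d_ge0 G sp s.
  exists k => //; rewrite kE /syzygy_dim !sum4 !big_ord_recr !big_ord0 /= !add0r e0 e1.
  by rewrite /cokernel_count -type2.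
have [k Hk kE] := coker t; exists k => //.
apply: (dim_saturated F_homog F_neq0 F_primitive r_gen r_homog G sp) Hk.
exists (d j0 + d j1 + d j2 + d j3) => s u sle.
have [k' + k'E] := coker s.
have k'0 : k' = 0%N.
  have [d01 d12 d23] := d_sorted.
  by have := cokernel_count_large (d_ge0 j0) d01 d12 d23 sle; lia.
by rewrite k'0 => H0 Hu; apply: (qdim_zero_sub H0).
Qed.

End TypeTwo.

(** Otherwise g i could be eliminated from the generators. *)
Lemma minimal_generators_irredundant (A : pzRingType) (V : lmodType A)
    (M : V -> Prop) m (g : 'I_m -> V) i (c : 'I_m -> A) :
  minimal_generators M g -> g i = \sum_j c j *: g j -> c i = 0 -> False.
Proof.
move=> [g_gen g_min] giE ci0.
have : [set~ i] = [set: 'I_m]; last by move=> /setP/(_ i); rewrite !inE eqxx.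
apply: g_min => v; split=> [/g_gen [a ->]|[a ->]].
  exists (fun j => a j + a i * c j).
  rewrite (eq_bigl xpredT) => [|j]; last by rewrite inE.
  rewrite [RHS](eq_bigl (fun j => j != i)) => [|j]; last by rewrite !inE.
  rewrite (bigD1 i) //= giE (bigD1 i) //= ci0 scale0r add0r scaler_sumr addrC.
  by rewrite -big_split; apply: eq_bigr => j _; rewrite /= scalerDl scalerA.
apply/g_gen; exists (fun j => if j == i then 0 else a j).
rewrite (eq_bigl (fun j => j != i)) => [|j]; last by rewrite !inE.
rewrite [RHS](eq_bigl xpredT) => [|j]; last by rewrite inE.
rewrite [RHS](bigD1 i) //= eqxx scale0r add0r.
by apply: eq_bigr => j /negPf ->.
Qed.


Section Gradient.
Variables (K : numFieldType) (n : nat).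
Local Notation S := {mpoly K[n]}.
Implicit Types (f g p : S).

Lemma mem_msupp_mderiv i f (m : 'X_{1..n}) :
  m \in msupp f^`M(i) -> (m + U_(i))%MM \in msupp f.
Proof. by rewrite !mcoeff_msupp mcoeff_deriv; apply: contraNN => /eqP ->; rewrite mul0rn. Qed.

Lemma mderiv_homog d i f : f \is d.-homog -> ihomog (d%:Z - 1) f^`M(i).
Proof.
move=> Hf; have md (m : 'X_{1..n}) : m \in msupp f^`M(i) -> (mdeg m).+1 = d.
  by move=> /mem_msupp_mderiv /(dhomog_mf Hf) /=; rewrite mdegD mdeg1 addn1.
case: d Hf md => [|d] Hf md.
  rewrite /= -msupp_eq0; case E : (msupp _) => [//|m s].
  by have := md m; rewrite E mem_head => /(_ isT).
rewrite (_ : d.+1%:Z - 1 = d%:Z); last by lia.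
by apply/dhomogP => m /md [].
Qed.

Lemma euler_mderiv d f : f \is d.-homog -> \sum_i 'X_i * f^`M(i) = d%:R *: f.
Proof.
move=> Hf; have eX (m : 'X_{1..n}) i : 'X_i * 'X_[m]^`M(i) = (m i)%:R *: 'X_[m] :> S.
  rewrite mderivX -scalerAr -mpolyXD; case E : (m i) => [|k]; first by rewrite !scale0r.
  rewrite addmC submK //; apply/mnm_lepP => j; rewrite mnm1E.
  by case: eqP => [<-|//]; rewrite E.
have e i : 'X_i * f^`M(i) = \sum_(m <- msupp f) f@_m *: ((m i)%:R *: 'X_[m]).
  rewrite {1}[f]mpolyE raddf_sum mulr_sumr; apply: eq_bigr => m _.
  by rewrite /= mderivZ -scalerAr eX.
under eq_bigr => i _ do rewrite e.
rewrite exchange_big /= [in RHS](mpolyE f) scaler_sumr; apply: eq_big_seq => m mf.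
rewrite -scaler_sumr -scaler_suml -natr_sum -mdegE (dhomog_mf Hf mf) /=.
by rewrite !scalerA mulrC.
Qed.

Lemma msize_mderiv i f : (msize f^`M(i) <= (msize f).-1)%N.
Proof.
rewrite msizeE; apply/bigmax_leqP_seq => m /mem_msupp_mderiv /msize_mdeg_lt + _.
by rewrite mdegD mdeg1 addn1; case: (msize f).
Qed.

Lemma mderiv0_const p : (forall i, p^`M(i) = 0) -> p = (p@_0)%:MP.
Proof.
move=> p0; apply/mpolyP => m; rewrite mcoeffC; case: eqVneq => [->|m0].
  by rewrite mulr1.
rewrite mulr0; have [i mi] : exists i, m i != 0%N.
  apply/existsP; apply: contraNT m0 => /existsPn H.
  by apply/eqP/mnmP => i; have := H i; rewrite negbK mnm0E => /eqP.
have Ui : (m - U_(i) + U_(i) = m)%MM.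
  by rewrite submK //; apply/mnm_lepP => j; rewrite mnm1E; case: eqP => [<-|//]; rewrite lt0n.
have := congr1 (mcoeff (m - U_(i))) (p0 i); rewrite mcoeff_deriv Ui mcoeff0 => /eqP.
by rewrite mulrn_eq0 => /orP [|/eqP].
Qed.

(** By Euler's formula p divides f = p q, so p divides the products of q with the
partial derivatives of p.  If p divides q, its square divides f; otherwise p divides
its own derivatives, which have smaller degree, so they vanish and p is constant. *)
Lemma gradient_primitive d f : (0 < d)%N -> f \is d.-homog -> squarefree f ->
  forall p : S, prime_elt p -> ~ forall i, divides p f^`M(i).
Proof.
move=> d0 Hf [f0 sqf] p [p0 NUp pP] pf.
have [q fE] : divides p f.
  have : divides p (d%:R *: f).
    by rewrite -(euler_mderiv Hf); apply: divides_sum => i _; apply: divides_mulr.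
  case=> q E; exists (d%:R^-1 *: q); rewrite -scalerAl -E scalerA mulVf ?scale1r //.
  by rewrite pnatr_eq0 -lt0n.
have [[h qE]|Npq] := boolp.EM (divides p q).
  by case/negP: NUp; apply: (sqf p h); rewrite fE qE; ring.
case/negP: NUp.
have dp i : p^`M(i) = 0.
  have /pP [//|[u uE]] : divides p (q * p^`M(i)).
    have -> : q * p^`M(i) = f^`M(i) - q^`M(i) * p by rewrite fE mderivM; ring.
    by apply: dividesB => //; exists q^`M(i).
  apply/eqP; apply: contraT => nz; have u0 : u != 0.
    by apply: contraNneq nz => E; rewrite uE E mul0r.
  have := msize_mderiv i p; rewrite uE msizeM //.
  have : (0 < msize u)%N by rewrite lt0n msize_poly_eq0.
  have : (0 < msize p)%N by rewrite lt0n msize_poly_eq0.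
  by move: (msize u) (msize p) => a b; lia.
rewrite (mderiv0_const dp) rmorph_unit // unitfE.
by apply: contraNneq p0 => E; rewrite (mderiv0_const dp) E mpolyC0.
Qed.

End Gradient.

Section Saturation.
Variables (K : fieldType) (g : 'I_3 -> {mpoly K[3]}).
Local Notation S := {mpoly K[3]}.
Local Notation J := (ideal_gen g).

Lemma ideal_genZ a p : J p -> J (a * p).
Proof.
by move=> [c ->]; exists (fun i => a * c i); rewrite mulr_sumr; apply: eq_bigr => i _; rewrite mulrA.
Qed.

Lemma ideal_genD p q : J p -> J q -> J (p + q).
Proof.
move=> [c ->] [c' ->]; exists (fun i => c i + c' i); rewrite -big_split /=.
by apply: eq_bigr => i _; rewrite mulrDl.
Qed.

Lemma ideal_genE p : J p <-> exists a : 'rV_3, const_mx p = a *m \col_i g i :> 'M_1.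
Proof.
split=> [[c ->]|[a /matrixP/(_ 0 0)]].
  by exists (\row_i c i); apply/matrixP => i j; rewrite !mxE; apply: eq_bigr => k _; rewrite !mxE.
by rewrite !mxE => ->; exists (a 0); apply: eq_bigr => k _; rewrite mxE.
Qed.

(** Expand the first factor into multiples of the variables: moving a variable over
to p lowers the corresponding exponent a i by one. *)
Lemma product_absorb s (a : 'I_3 -> nat) p (u : 'I_s -> S) :
  (\sum_i a i <= s)%N -> (forall i, ideal_gen (fun i => 'X_i) (u i)) ->
  (forall i, J ('X_i ^+ a i * p)) -> J ((\prod_(i < s) u i) * p).
Proof.
elim: s a p u => [|s IH] a p u as_ uI aJ.
  have := aJ i0; rewrite (_ : a i0 = 0%N); first by rewrite big_ord0 expr0.
  by apply/eqP; rewrite -leqn0 (leq_trans _ as_) // (bigD1 i0) //= leq_addr.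
have [[i ai]|H] := boolp.EM (exists i, a i = 0%N).
  by apply: ideal_genZ; have := aJ i; rewrite ai expr0 mul1r.
have [c cE] := uI ord0; rewrite big_ord_recl cE -mulrA mulr_suml.
elim/big_rec: _ => [|i y _ Jy]; first by exists (fun=> 0); rewrite big1 // => j _; rewrite mul0r.
apply: ideal_genD => //; rewrite -mulrA; apply: ideal_genZ; rewrite mulrCA.
apply: (IH (fun k => if k == i then (a i).-1 else a k)) => [|k|k].
- have : (0 < a i)%N by rewrite lt0n; apply/eqP => E; apply: H; exists i.
  move: as_; rewrite (bigD1 i) //= [X in _ -> _ -> (X <= _)%N](bigD1 i) //= eqxx.
  rewrite [in X in _ -> _ -> X](eq_bigr a) => [|k /negPf ->//].
  by case: (a i) => // m; rewrite addSn ltnS.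
- exact: uI.
case: eqP => [->|_].
  rewrite mulrA -exprSr prednK //.
  by rewrite lt0n; apply/eqP => E; apply: H; exists i.
by rewrite mulrCA; apply: ideal_genZ.
Qed.

Lemma saturationE p : saturation (ideal_gen (fun i : 'I_3 => 'X_i : S)) J p <->
  exists n, forall i, J ('X_i ^+ n * p).
Proof.
split=> [[k H]|[n H]].
  exists k => i; have := H (fun=> 'X_i); rewrite prodr_const card_ord; apply.
  by move=> _; exists (fun j => (j == i)%:R); rewrite (bigD1 i) //= eqxx mul1r big1 ?addr0 // => j /negPf ->; rewrite mul0r.
by exists (\sum_(i < 3) n)%N => u uI; apply: (product_absorb (a := fun=> n)).
Qed.

End Saturation.

Lemma quotient_dim_qdim (K : fieldType) (V : lmodType K) (U W : V -> Prop) k :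
  qdim (GRing.RMorphism.clone _ _ (@idfun K) _) U W k -> quotient_dim U W k.
Proof.
case=> v [Uv spv frv]; exists v; split=> // [u Uu|a Wa i].
  by have [a Wa] := spv u Uu; exists (a 0).
have /rowP/(_ i) : \row_i a i = 0; last by rewrite !mxE.
apply: frv; rewrite /lincomb.
by under eq_bigr => j _ do rewrite mxE.
Qed.

Section JacobianModule.
Variables (R : realType) (d : nat) (f : {mpoly R[i][3]}).
Local Notation S := {mpoly R[i][3]}.
Let F : 'cV[S]_3 := \col_i f^`M(i).

Lemma jacobian_idealE p : jacobian_ideal f p <-> exists a, const_mx p = a *m F :> 'M_1.
Proof. exact: ideal_genE. Qed.

Lemma saturated_jacobian_idealE p : saturated_jacobian_ideal f p <-> saturated F (const_mx p).
Proof.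
rewrite /saturated_jacobian_ideal saturationE.
have E n i : 'X_i ^+ n *: const_mx p = const_mx ('X_i ^+ n * p) :> 'M[S]_1.
  by apply/matrixP => a b; rewrite !mxE.
split=> -[n H]; exists n => i.
  by rewrite E; apply: (jacobian_idealE _).1; apply: H.
by apply: (jacobian_idealE _).2; rewrite -E; apply: H.
Qed.

Lemma saturated_jacobian_subspace j :
  subspace (@idfun R[i]) (graded_part (saturated_jacobian_ideal f) j).
Proof.
have raise n m i p : jacobian_ideal f ('X_i ^+ n * p) -> jacobian_ideal f ('X_i ^+ (m + n) * p).
  by rewrite exprD -mulrA; apply: ideal_genZ.
split=> [|a p q [/saturationE [n Hp] hp] [/saturationE [m Hq] hq]].
  split; last exact: rpred0.
  apply/saturationE; exists 0%N => i; rewrite mulr0.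
  by exists (fun=> 0); rewrite big1 // => k _; rewrite mul0r.
split; last by apply: rpredD => //; apply: rpredZ.
apply/saturationE; exists (m + n)%N => i; rewrite mulrDr -scalerAr -mul_mpolyC.
by apply: ideal_genD; [apply/ideal_genZ/raise/Hp | rewrite addnC; apply/raise/Hq].
Qed.

(** Row vectors of length one stand for polynomials. *)
Lemma jacobian_module_dimE (j k : nat) t N : j%:Z = t + N ->
  qdim (@mpolyC 3 R[i]) (fun x => vhomog (fun=> N) t x /\ saturated F x)
    (im_part (fun=> N) F t) k ->
  jacobian_module_dim f j k.
Proof.
move=> jE Hk; apply: quotient_dim_qdim.
have hE (x : 'rV[S]_1) : vhomog (fun=> N) t x <-> x 0 0 \is j.-homog.
  by split=> [/(_ 0)|Hx i]; rewrite ?ord1 -jE.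
have xE (x : 'rV[S]_1) : const_mx (x 0 0) = x by apply/rowP => i; rewrite mxE ord1.
pose E (p : S) (x : 'rV[S]_1) := p = x 0 0.
apply: (qdim_correspondence (E := E)) Hk.
- exact: saturated_jacobian_subspace.
- have [h0 hl] := saturated_jacobian_subspace j.
  have U (x : 'rV[S]_1) : graded_part (saturated_jacobian_ideal f) j (x 0 0) <->
      vhomog (fun=> N) t x /\ saturated F x.
    split=> [[/saturated_jacobian_idealE + Hx]|[Hx Sx]]; first by rewrite xE => Sx; split=> //; apply/hE.
    by split; [apply/saturated_jacobian_idealE; rewrite xE | apply/hE].
  split=> [|a u v /U Hu /U Hv]; first by apply/U; rewrite mxE.
  by apply/U; rewrite !mxE mul_mpolyC; apply: hl.
- by rewrite /E mxE.
- by move=> a p q x y -> ->; rewrite /E !mxE mul_mpolyC.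
- move=> x [Hx Sx]; exists (x 0 0) => //; split; last exact/hE.
  by apply/saturated_jacobian_idealE; rewrite xE.
- move=> p [/saturated_jacobian_idealE Sp Hp]; exists (const_mx p); last by rewrite /E mxE.
  by split=> //; apply/hE; rewrite mxE.
- move=> p x [_ Hp] [Hx _] ->; split=> [[/jacobian_idealE [a aE] _]|[_ [a aE]]].
    by split=> //; exists a; rewrite -aE xE.
  split; last exact/hE.
  by apply/jacobian_idealE; exists a; rewrite xE.
Qed.

End JacobianModule.

Theorem proposition1p14 (R : realType) (d : nat) (f : {mpoly R[i][3]})
    (d1 d2 d3 d4 : nat) :
  (3 <= d)%N ->
  reduced_curve d f ->
  exponents f [:: d1; d2; d3; d4] ->
  type2B d [:: d1; d2; d3; d4] ->
  exists nu : nat, freeness_defect f nu /\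
    [/\ d1%:Z < d2%:Z - 2 ->
          nu%:Z = d3%:Z + d4%:Z - 2 * d2%:Z + 3 /\ (3 <= nu)%N,
        d1%:Z = d2%:Z - 2 ->
          nu%:Z = d3%:Z + d4%:Z - 2 * d1%:Z - 1 /\ (3 <= nu)%N,
        d1%:Z = d2%:Z - 1 ->
          nu%:Z = d3%:Z + d4%:Z - 2 * d1%:Z + 1 /\ (3 <= nu)%N
      & d1 = d2 ->
          nu%:Z = d3%:Z + d4%:Z - 2 * d2%:Z + 2 /\ (2 <= nu)%N].
Proof.
move=> d_ge3 [f_homog f_sqf] [/= /and4P [d12 d23 d34 _] [r [r_gens r_homog]]].
rewrite /type2B /curve_type /= => -[type2 _].
pose F : 'cV[{mpoly R[i][3]}]_3 := \col_i f^`M(i).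
pose D (i : 'I_4) : int := (nth 0%N [:: d1; d2; d3; d4] i)%:Z.
have [r_gen _] := r_gens.
have syzE w : syzygy F w <-> jacobian_syzygy f w.
  rewrite /syzygy /jacobian_syzygy; split=> [/matrixP/(_ 0 0)|E].
    by rewrite !mxE => E; rewrite -[RHS]E; apply: eq_bigr => i _; rewrite mxE.
  apply/matrixP => a b; rewrite !ord1 [RHS]mxE -[RHS]E mxE.
  by apply: eq_bigr => i _; rewrite mxE.
have mulr_sum (c : 'rV_4) : c *m \matrix_i r i = \sum_i c 0 i *: r i.
  by rewrite mulmx_sum_row; apply: eq_bigr => i _; rewrite rowK.
have F_homog k : ihomog (d%:Z - 1) (F k 0) by rewrite mxE; apply: mderiv_homog.
have F_prim p : prime_elt p -> ~ forall k, divides p (F k 0).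
  move=> pp pF; apply: (gradient_primitive _ f_homog f_sqf pp); first by apply: leq_trans d_ge3.
  by move=> i; have := pF i; rewrite mxE.
have gen w : syzygy F w <-> exists c : 'rV_4, w = c *m \matrix_i r i.
  rewrite syzE r_gen; split=> [[c ->]|[c ->]].
    exists (\row_i c i); rewrite mulr_sum; apply: eq_big => i; first by rewrite inE.
    by rewrite mxE.
  exists (c 0); rewrite mulr_sum; apply: eq_bigl => i; by rewrite inE.
have rH i : vhomog (fun=> 0) (D i) (r i) by move=> k; rewrite addr0; apply: r_homog.
have minimal i (c : 'rV_4) : r i = c *m \matrix_i r i -> c 0 i = 0 -> False.
  rewrite mulr_sum => riE ci0.
  exact: (minimal_generators_irredundant (c := fun j => c 0 j) r_gens riE ci0).
have D_ge0 i : 0 <= D i by [].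
have D_sorted : [/\ D j0 <= D j1, D j1 <= D j2 & D j2 <= D j3] by [].
have ND : d%:Z - 1 = D j0 + D j1 - 2 by rewrite /D /=; lia.
have dimN := dim_jacobian_module F_homog F_prim gen rH minimal D_ge0 D_sorted ND.
have [D01 D12 D23] := D_sorted.
have [nu nuD nuE] := dimN (D j0 - 2).
rewrite cokernel_count_middle // in nuE.
exists nu; split; first split.
- exists (absz (D j0 - 2 + (d%:Z - 1))%R); apply: jacobian_module_dimE nuD.
  by rewrite ND /D /=; lia.
- move=> j; have [k kD kE] := dimN (j%:Z - (d%:Z - 1)).
  exists k; first by apply: jacobian_module_dimE kD; ring.
  have := cokernel_count_max (D_ge0 j0) D01 D12 D23 (j%:Z - (d%:Z - 1)).
  by rewrite -kE -nuE.
move: nuE; rewrite /defect /D /=; case: eqP => [[E]|NE] nuE; split; lia.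
Qed.
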